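(* Let $1\le p\le n$ and let $f:\mathbb{C}^{n\times n}\to\mathbb{R}$ be smooth. Let $R^E$ be a retraction on the embedded manifold $\mathcal{H}^{n,p}_+$ and $\mathcal{T}^E$ a vector transport on $\mathcal{H}^{n,p}_+$ whose associated retraction is $R^E$. On the Riemannian quotient manifold $(\mathbb{C}^{n\times p}_*/\mathcal{O}_p,g^3)$ define $$R^Q_{\pi(Y)}(\xi_{\pi(Y)})=\tilde\beta^{-1}\Big(R^E_{\tilde\beta(\pi(Y))}\big(L_{\pi(Y)}(\xi_{\pi(Y)})\big)\Big),\qquad \mathcal{T}^Q_{\eta_{\pi(Y)}}(\xi_{\pi(Y)})=L_{\pi(Y_2)}^{-1}\Big(\mathcal{T}^E_{L_{\pi(Y)}(\eta_{\pi(Y)})}\big(L_{\pi(Y)}(\xi_{\pi(Y)})\big)\Big),$$ where $\tilde\beta(\pi(Y_2))$ is the foot of $\mathcal{T}^E_{L_{\pi(Y)}(\eta_{\pi(Y)})}(L_{\pi(Y)}(\xi_{\pi(Y)}))$. Then the Riemannian conjugate gradient method on $(\mathbb{C}^{n\times p}_*/\mathcal{O}_p,g^3)$ for minimizing $h(\pi(Y))=f(YY^* )$ with retraction $R^Q$, vector transport $\mathcal{T}^Q$ and initial steps $t_k=\arg\min_t f\big(Y_{k-1}Y_{k-1}^*+t(Y_{k-1}\overline\eta_{k-1}^*+\overline\eta_{k-1}Y_{k-1}^* )\big)$ is equivalent to the Riemannian conjugate gradient method on the embedded manifold $\mathcal{H}^{n,p}_+$ for minimizing $f$ with retraction $R^E$,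 vector transport $\mathcal{T}^E$ and initial steps $t_k=\arg\min_t f(X_{k-1}+t\eta_{k-1})$ (both methods are written out in the context), in the sense that they produce exactly the same iterates: if $X_0=\tilde\beta(\pi(Y_0))=Y_0Y_0^*$, then $X_k=\tilde\beta(\pi(Y_k))=Y_kY_k^*$ for all $k$ for which the iterates are defined.
   Context: Complex matrix spaces are real vector spaces with inner product $\langle A,B\rangle=\Re(\mathrm{tr}(A^*B))$. $\mathcal{H}^{n,p}_+$ is the manifold of $n\times n$ Hermitian positive semidefinite matrices of rank $p$, an embedded submanifold of $\mathbb{C}^{n\times n}$, with metric $g_X(\zeta_1,\zeta_2)=\Re(\mathrm{tr}(\zeta_1^*\zeta_2))$. $\mathbb{C}^{n\times p}_*$ is the set of rank-$p$ matrices in $\mathbb{C}^{n\times p}$, $\mathcal{O}_p$ is the group of $p\times p$ unitary matrices acting by $Y\mapsto YO$, and $\pi:\mathbb{C}^{n\times p}_*\to\mathbb{C}^{n\times p}_*/\mathcal{O}_p$ is the projection. The map $\tilde\beta:\mathbb{C}^{n\times p}_*/\mathcal{O}_p\to\mathcal{H}^{n,p}_+$, $\tilde\beta(\pi(Y))=YY^*$, is a diffeomorphism, and $L_{\pi(Y)}=\mathrm{D}\tilde\beta(\pi(Y)):T_{\pi(Y)}(\mathbb{C}^{n\times p}_*/\mathcal{O}_p)\to T_{YY^*}\mathcal{H}^{n,p}_+$ is the resulting isomorphism. The metric $g^3$ on $\mathbb{C}^{n\times p}_*$ is $$g^3_Y(A,B)=\langle YA^*+AY^*,YB^*+BY^*\rangle+\langle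 P^{\mathcal V}_Y(A)Y^*,P^{\mathcal V}_Y(B)Y^*\rangle,\quad P^{\mathcal V}_Y(A)=Y\,\frac{(Y^*Y)^{-1}Y^*A-A^*Y(Y^*Y)^{-1}}{2}.$$ The vertical space at $Y$ is $\{Y\Omega:\Omega^*=-\Omega\}$; the horizontal space is its $g^3$-orthogonal complement; $\overline\xi_Y$ denotes the horizontal lift of $\xi_{\pi(Y)}$, the unique horizontal vector with $\mathrm{D}\pi(Y)[\overline\xi_Y]=\xi_{\pi(Y)}$. The induced quotient metric is $g^3_{\pi(Y)}(\xi,\zeta)=g^3_Y(\overline\xi_Y,\overline\zeta_Y)$. A retraction on $\mathcal{M}$ is a smooth map $R:T\mathcal{M}\to\mathcal{M}$ with $R_x(0_x)=x$ and $\mathrm{D}R_x(0_x)=\mathrm{id}$. A vector transport on $\mathcal{M}$ is a smooth map $(\eta_x,\xi_x)\mapsto\mathcal{T}_{\eta_x}(\xi_x)\in T\mathcal{M}$ such that, for an associated retraction $R$, $\mathcal{T}_{\eta_x}(\xi_x)\in T_{R_x(\eta_x)}\mathcal{M}$ (the foot of $\mathcal{T}_{\eta_x}(\xi_x)$ is $R_x(\eta_x)$), $\mathcal{T}_{0_x}\xi_x=\xi_x$, and $\mathcal{T}_{\eta_x}$ is linear. Riemannian conjugate gradient method for a cost $\phi$ on a Riemannian manifold $(\mathcal{M},g)$ with retraction $R$, vector transport $\mathcal{T}$ and a rule for the initial steps: start with $x_0$, $\xi_0=\operatorname{grad}\phi(x_0)$, $\eta_0=-\xi_0$, tolerance $\varepsilon>0$.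 For $k=1,2,\dots$: (1) compute the initial step $t_k$; (2) find the smallest integer $m\ge0$ with $\phi(x_{k-1})-\phi(R_{x_{k-1}}(0.5^mt_k\eta_{k-1}))\ge-0.0001\cdot0.5^mt_k\,g_{x_{k-1}}(\xi_{k-1},\eta_{k-1})$ and set $\zeta_k=0.5^mt_k\eta_{k-1}$; (3) $x_k=R_{x_{k-1}}(\zeta_k)$; (4) $\xi_k=\operatorname{grad}\phi(x_k)$; (5) stop if $\sqrt{g_{x_k}(\xi_k,\xi_k)}<\varepsilon$ or $\phi(x_k)<\varepsilon$; (6) $\eta_k=-\xi_k+\beta_k\mathcal{T}_{\zeta_k}(\eta_{k-1})$ with $\beta_k=g_{x_k}(\xi_k,\xi_k-\mathcal{T}_{\zeta_k}(\xi_{k-1}))/g_{x_{k-1}}(\xi_{k-1},\xi_{k-1})$. The embedded method is the case $\mathcal{M}=\mathcal{H}^{n,p}_+$, $\phi=f$, $x_k=X_k$; the quotient method is the case $\mathcal{M}=\mathbb{C}^{n\times p}_*/\mathcal{O}_p$, $\phi=h$, $x_k=\pi(Y_k)$, where $\overline\eta_{k}$ is the horizontal lift of $\eta_k$ at the representative $Y_k$. Both methods use the same tolerance, and if the scalar minimization defining $t_k$ has several minimizers, both methods select by the same rule. *)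

(* Defs.v *)
From HB Require Import structures.
From mathcomp Require Import all_boot all_order all_algebra.
From mathcomp Require Import complex.
From mathcomp Require Import all_classical all_reals all_analysis.

Set Implicit Arguments.
Unset Strict Implicit.
Unset Printing Implicit Defensive.

Import Order.TTheory GRing.Theory Num.Theory.
Import numFieldNormedType.Exports.

Local Open Scope classical_set_scope.
Local Open Scope ring_scope.
Local Open Scope complex_scope.
Local Open Scope sesquilinear_scope.

(* [cmat R m n] is an alias of ['M[R[i]]_(m, n)] that carries the structure
   obtained by restricting the scalars to R.  The norm below (maximum of the
   absolute values of all real and imaginary parts) is only used for its
   topology, which in finite dimension is that of the inner product [inner]. *)
Definition cmat (R : realType) (m n : nat) : Type := 'M[R[i]]_(m, n).

Section CMat.
Context {R : realType} {m n : nat}.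
Implicit Types A B : cmat R m n.

HB.instance Definition _ := GRing.Zmodule.copy (cmat R m n) 'M[R[i]]_(m, n).

Definition cmat_scale (a : R) A : cmat R m n := map_mx ( *%R a%:C) A.

Let scaleA a b A : cmat_scale a (cmat_scale b A) = cmat_scale (a * b) A.
Proof. by apply/matrixP => i j; rewrite !mxE rmorphM mulrA. Qed.

Let scale1 : left_id 1 cmat_scale.
Proof. by move=> A; apply/matrixP => i j; rewrite !mxE rmorph1 mul1r. Qed.

Let scaleDr : right_distributive cmat_scale +%R.
Proof. by move=> a A B; apply/matrixP => i j; rewrite !mxE mulrDr. Qed.

Let scaleDl A : {morph cmat_scale^~ A : a b / a + b}.
Proof. by move=> a b; apply/matrixP => i j; rewrite !mxE rmorphD mulrDl. Qed.

HB.instance Definition _ := GRing.Zmodule_isLmodule.Build R (cmat R m n)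
  scaleA scale1 scaleDr scaleDl.

Definition re_mx A : 'M[R]_(m, n) := map_mx (@complex.Re R) A.
Definition im_mx A : 'M[R]_(m, n) := map_mx (@complex.Im R) A.

Lemma re_mxD A B : re_mx (A + B) = re_mx A + re_mx B.
Proof. by apply/matrixP => i j; rewrite !mxE; case: (A i j) (B i j) => ? ? []. Qed.

Lemma im_mxD A B : im_mx (A + B) = im_mx A + im_mx B.
Proof. by apply/matrixP => i j; rewrite !mxE; case: (A i j) (B i j) => ? ? []. Qed.

Lemma re_mxZ (a : R) A : re_mx (a *: A) = a *: re_mx A.
Proof.
apply/matrixP => i j; rewrite !mxE; case: (A i j) => x y /=.
by rewrite mul0r subr0.
Qed.

Lemma im_mxZ (a : R) A : im_mx (a *: A) = a *: im_mx A.
Proof.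
apply/matrixP => i j; rewrite !mxE; case: (A i j) => x y /=.
by rewrite mul0r addr0.
Qed.

Definition cmat_norm A : R := Num.max `|re_mx A| `|im_mx A|.

Let normD A B : cmat_norm (A + B) <= cmat_norm A + cmat_norm B.
Proof.
rewrite /cmat_norm re_mxD im_mxD ge_max; apply/andP; split.
  by apply: (le_trans (ler_normD _ _)); rewrite lerD// le_max lexx.
by apply: (le_trans (ler_normD _ _)); rewrite lerD// le_max lexx orbT.
Qed.

Let normZ (a : R) A : cmat_norm (a *: A) = `|a| * cmat_norm A.
Proof. by rewrite /cmat_norm re_mxZ im_mxZ !normrZ maxr_pMr. Qed.

Let norm0_eq0 A : cmat_norm A = 0 -> A = 0.
Proof.
rewrite /cmat_norm => A0.
have /eqP rA : re_mx A == 0 by rewrite -normr_le0 -A0 le_max lexx.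
have /eqP iA : im_mx A == 0 by rewrite -normr_le0 -A0 le_max lexx orbT.
apply/matrixP => i j; rewrite !mxE.
have := congr1 (fun M : 'M[R]_(m, n) => M i j) rA.
have := congr1 (fun M : 'M[R]_(m, n) => M i j) iA.
by rewrite !mxE; case: (A i j) => x y /= -> ->.
Qed.

HB.instance Definition _ :=
  Lmodule_isNormed.Build R (cmat R m n) normD normZ norm0_eq0.

Definition inner A B : R := complex.Re (\tr (A^t* *m B)).

End CMat.

Section Smooth.
Context {R : realType}.

Fixpoint iter_derive (V W : normedModType R) (vs : seq V) (F : V -> W) : V -> W :=
  if vs is v :: vs' then 'D_v (iter_derive vs' F) else F.

(* C^infinity on U; meant for open U. *)
Definition smooth_on (V W : normedModType R) (U : set V) (F : V -> W) : Prop :=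
  forall (vs : seq V) (x : V), U x -> differentiable (iter_derive vs F) x.

(* Smoothness of a map defined on an embedded submanifold S of V: F is locally
   the restriction of a smooth map of the ambient space. *)
Definition smooth_sub (V W : normedModType R) (S : set V) (F : V -> W) : Prop :=
  forall x, S x -> exists (U : set V) (G : V -> W),
    [/\ open U, U x, smooth_on U G & forall y, S y -> U y -> G y = F y].

(* Velocities at x of the smooth curves of V that stay in S near time 0. *)
Definition tangent (V : normedModType R) (S : set V) (x : V) : set V :=
  [set v | exists (I : set R^o) (c : R^o -> V),
     [/\ open I, I 0, smooth_on I c, (forall t, I t -> S (c t)) &
         c 0 = x /\ is_derive (0 : R^o) 1 c v]].

Definition tangent_bundle (V : normedModType R) (S : set V) : set (V * V) :=
  [set z | S z.1 /\ tangent S z.1 z.2].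

Definition tangent_bundle2 (V : normedModType R) (S : set V) :
    set (V * V * V) :=
  [set z | [/\ S z.1.1, tangent S z.1.1 z.1.2 & tangent S z.1.1 z.2]].

(* The tangent vector (x, v) is mapped to [Rt x v]; the values outside the
   tangent bundle are irrelevant. *)
Definition retraction (V : normedModType R) (S : set V) (Rt : V -> V -> V) :
    Prop :=
  [/\ forall x v, S x -> tangent S x v -> S (Rt x v),
      smooth_sub (tangent_bundle S) (fun z => Rt z.1 z.2),
      forall x, S x -> Rt x 0 = x &
      forall x v, S x -> tangent S x v ->
        is_derive (0 : R^o) 1 (fun t : R^o => Rt x (t *: v)) v].

(* [Tr x u v] is the vector part of the transport of (x, v) along (x, u), the
   foot being [Rt x u]. *)
Definition vector_transport (V : normedModType R) (S : set V)
    (Rt : V -> V -> V) (Tr : V -> V -> V -> V) : Prop :=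
  [/\ retraction S Rt,
      forall x u v, S x -> tangent S x u -> tangent S x v ->
        tangent S (Rt x u) (Tr x u v),
      smooth_sub (tangent_bundle2 S) (fun z => Tr z.1.1 z.1.2 z.2),
      forall x v, S x -> tangent S x v -> Tr x 0 v = v &
      forall x u, S x -> tangent S x u ->
        forall (a : R) v w, tangent S x v -> tangent S x w ->
          Tr x u (a *: v + w) = a *: Tr x u v + Tr x u w].

End Smooth.

(* The data of a Riemannian manifold that the method uses.  The tangent space
   at x is the subset [tanspace x] of an ambient vector space [vec]; [dif phi x v]
   is D phi(x)[v]. *)
Record riemannian (R : realType) := Riemannian {
  pt : choiceType;
  vec : lmodType R;
  tanspace : pt -> set vec;
  metric : pt -> vec -> vec -> R;
  dif : (pt -> R) -> pt -> vec -> R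
}.

Section RCG.
Context {R : realType} (M : riemannian R).
Implicit Types (x : pt M) (phi : pt M -> R).

Definition grad phi x : vec M :=
  xget 0 [set xi | tanspace x xi /\
                   forall zeta, tanspace x zeta -> metric x xi zeta = dif phi x zeta].

(* Every quantity that may fail to exist is an option: the initial step (the
   scalar objective may have no minimizer), and the Armijo exponent m. *)
Context (phi : pt M -> R) (Rt : pt M -> vec M -> pt M)
  (Tr : pt M -> vec M -> vec M -> vec M)
  (step : nat -> pt M -> vec M -> option R) (eps : R).

Definition armijo x (xi eta : vec M) (t : R) (m : nat) : bool :=
  phi x - phi (Rt x ((2^-1 ^+ m * t) *: eta)) >=
    - (10 ^- 4 * (2^-1 ^+ m * t) * metric x xi eta).

Definition armijo_exponent x (xi eta : vec M) (t : R) : option nat :=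
  if pselect (exists m, armijo x xi eta t m) is left e
  then Some (ex_minn e) else None.

(* (x_k, Some (xi_k, eta_k)), or (x_k, None) when the method stops at x_k. *)
Definition state : Type := (pt M * option (vec M * vec M))%type.

Definition rcg_step (k : nat) (s : state) : option state :=
  if s is (x, Some (xi, eta)) then
    if step k x eta is Some t then
      if armijo_exponent x xi eta t is Some m then
        let zeta := (2^-1 ^+ m * t) *: eta in
        let x' := Rt x zeta in
        let xi' := grad phi x' in
        if (Num.sqrt (metric x' xi' xi') < eps) || (phi x' < eps)
        then Some (x', None)
        else
          let beta := metric x' xi' (xi' - Tr x zeta xi) / metric x xi xi in
          Some (x', Some (xi', - xi' + beta *: Tr x zeta eta))
      else None
    else None
  else None.

Fixpoint rcg_state (x0 : pt M) (k : nat) : option state :=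
  if k is k'.+1 then obind (rcg_step k') (rcg_state x0 k')
  else Some (x0, Some (grad phi x0, - grad phi x0)).

Definition rcg_iterate (x0 : pt M) (k : nat) : option (pt M) :=
  omap fst (rcg_state x0 k).

End RCG.

Section InitialStep.
Context {R : realType}.

Definition minimizer (u : R -> R) (t : R) : Prop := forall s, u t <= u s.

(* A rule choosing one minimizer for each scalar objective that has one; it
   may depend on the iteration number. *)
Definition selection_rule (sel : nat -> (R -> R) -> R) : Prop :=
  forall k u, (exists t, minimizer u t) -> minimizer u (sel k u).

Definition argmin (sel : nat -> (R -> R) -> R) (k : nat) (u : R -> R) :
    option R :=
  if `[< exists t, minimizer u t >] then Some (sel k u) else None.

End InitialStep.

Section Embedded.
Context {R : realType} (n p : nat).

Definition psd_rank : set (cmat R n n) :=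
  [set X | [/\ (X : 'M[R[i]]_n) \is hermsymmx,
               forall u : 'cV[R[i]]_n, 0 <= (u^t* *m X *m u) 0 0 &
               \rank X = p]].

(* The costs considered are restrictions of smooth functions of the ambient
   space, whose differential is the ambient directional derivative. *)
Definition psd_manifold : riemannian R :=
  @Riemannian R (cmat R n n) (cmat R n n) (tangent psd_rank)
    (fun _ => inner)
    (fun phi X V => 'D_V (phi : cmat R n n -> R^o) X).

Definition step_embedded (sel : nat -> (R -> R) -> R) (f : cmat R n n -> R)
    (k : nat) (X eta : cmat R n n) : option R :=
  argmin sel k (fun t => f (X + t *: eta)).

End Embedded.
Arguments psd_rank R n p : clear implicits.
Arguments psd_manifold R n p : clear implicits.

Section Quotient.
Context {R : realType} (n p : nat).
Implicit Types (Y A B : cmat R n p).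

Definition fullrank : set (cmat R n p) := [set Y | \rank Y = p].

Definition quot : Type := set (cmat R n p).
HB.instance Definition _ := Choice.on quot.

Definition qproj Y : quot :=
  [set (Y *m O : cmat R n p) | O in [set O : 'M[R[i]]_p | O \is unitarymx]].

Definition quotient_set : set quot := qproj @` fullrank.

(* The quotient manifold structure: a function is smooth iff its composition
   with the projection is. *)
Definition smooth_quot (phi : quot -> R) : Prop :=
  smooth_on fullrank (phi \o qproj : cmat R n p -> R^o).

(* Tangent vectors act on smooth functions; the value 0 elsewhere only makes
   them total, so that equality means equality on smooth functions. *)
Definition qvec : Type := (quot -> R) -> R^o.
HB.instance Definition _ := GRing.Lmodule.on qvec.

(* D pi(Y)[A], the velocity of t |-> pi(Y + t A) at t = 0. *)
Definition Dproj Y A : qvec :=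
  fun phi => if `[< smooth_quot phi >]
             then 'D_A (phi \o qproj : cmat R n p -> R^o) Y else 0.

(* The projection being a submersion, its differentials are onto. *)
Definition tangent_quot (q : quot) : set qvec :=
  [set xi | exists Y A, [/\ fullrank Y, qproj Y = q & xi = Dproj Y A]].

Definition vproj Y A : cmat R n p :=
  let G := invmx (Y^t* *m Y) in
  Y *m (2^-1 *: (G *m Y^t* *m A - A^t* *m Y *m G)).

Definition g3 Y A B : R :=
  inner (Y *m A^t* + A *m Y^t* : cmat R n n) (Y *m B^t* + B *m Y^t*)
  + inner (vproj Y A *m Y^t* : cmat R n n) (vproj Y B *m Y^t*).

Definition vertical Y : set (cmat R n p) :=
  [set (Y *m Om : cmat R n p) | Om in [set Om : 'M[R[i]]_p | Om^t* = - Om]].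

Definition horizontal Y : set (cmat R n p) :=
  [set A | forall B, vertical Y B -> g3 Y A B = 0].

Definition hlift Y (xi : qvec) : cmat R n p :=
  xget 0 [set A | horizontal Y A /\ Dproj Y A = xi].

Definition orbit_repr (q : quot) : cmat R n p := xget 0 q.

Definition quot_metric (q : quot) (xi zeta : qvec) : R :=
  g3 (orbit_repr q) (hlift (orbit_repr q) xi) (hlift (orbit_repr q) zeta).

Definition quot_manifold : riemannian R :=
  @Riemannian R quot qvec tangent_quot quot_metric (fun phi _ xi => xi phi).

Definition tbeta (q : quot) : cmat R n n := orbit_repr q *m (orbit_repr q)^t*.

Definition tbeta_inv (X : cmat R n n) : quot :=
  xget set0 [set q | quotient_set q /\ tbeta q = X].

(* L = D tbeta: a tangent vector acts on each real coordinate of tbeta. *)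
Definition Dtbeta (xi : qvec) : cmat R n n :=
  \matrix_(i, j) ((xi (fun q => complex.Re (tbeta q i j)))
                  +i* (xi (fun q => complex.Im (tbeta q i j)))).

Definition Dtbeta_inv (q : quot) (V : cmat R n n) : qvec :=
  xget 0 [set xi | tangent_quot q xi /\ Dtbeta xi = V].

Definition quot_retraction (RE : cmat R n n -> cmat R n n -> cmat R n n)
    (q : quot) (xi : qvec) : quot :=
  tbeta_inv (RE (tbeta q) (Dtbeta xi)).

(* The orbit q2 is the one sent by tbeta to the foot of the transported
   vector. *)
Definition quot_transport (RE : cmat R n n -> cmat R n n -> cmat R n n)
    (TE : cmat R n n -> cmat R n n -> cmat R n n -> cmat R n n)
    (q : quot) (eta xi : qvec) : qvec :=
  let q2 := tbeta_inv (RE (tbeta q) (Dtbeta eta)) in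
  Dtbeta_inv q2 (TE (tbeta q) (Dtbeta eta) (Dtbeta xi)).

(* [rep k q] is the representative of q used at iteration k. *)
Definition step_quotient (sel : nat -> (R -> R) -> R) (f : cmat R n n -> R)
    (rep : nat -> quot -> cmat R n p) (k : nat) (q : quot) (eta : qvec) :
    option R :=
  let Y := rep k q in
  let H := hlift Y eta in
  argmin sel k (fun t : R =>
    f ((Y *m Y^t* : cmat R n n) + t *: (Y *m H^t* + H *m Y^t* : cmat R n n))).

Lemma qproj_id Y : qproj Y Y.
Proof.
exists 1%:M; last by rewrite mulmx1.
by apply/unitarymxP; rewrite trmx1 map_mx1 mulmx1.
Qed.

Lemma tbetaE Y : tbeta (qproj Y) = Y *m Y^t*.
Proof.
have [W /= UW YW] : qproj Y (orbit_repr (qproj Y)).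
  by apply: xgetPex; exists Y; exact: qproj_id.
rewrite /tbeta -YW trmx_mul map_mxM mulmxA -(mulmxA Y).
by rewrite (unitarymxP UW) mulmx1.
Qed.

End Quotient.
Arguments quot R n p : clear implicits.
Arguments quot_manifold R n p : clear implicits.

(* Main.v *)
(* Every object of the quotient method is the image under D tbeta of the
   corresponding object of the embedded method. A horizontal vector H satisfies
   P^V_Y(H) = 0, so that g^3_Y(H, K) = <YH* + HY*, YK* + KY*>: hence D tbeta,
   which maps D pi(Y)[H] to YH* + HY*, is isometric and gradients correspond.
   It is onto because a curve of positive semidefinite matrices through YY*
   minimizes u* X u at time 0 for every u in the kernel of Y*; its velocity V is then a
   Hermitian matrix with no component in ker Y*, which has the form YA* + AY*. *)

Require Import Defs.
From HB Require Import structures.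
From mathcomp Require Import all_boot all_order all_algebra.
From mathcomp Require Import complex.
From mathcomp Require Import all_classical all_reals all_analysis.
Import Order.TTheory GRing.Theory Num.Theory.
Import numFieldNormedType.Exports.
Local Open Scope classical_set_scope.
Local Open Scope ring_scope.
Local Open Scope complex_scope.
Local Open Scope sesquilinear_scope.

Set Implicit Arguments.
Unset Strict Implicit.
Unset Printing Implicit Defensive.

(** A tangent vector of the quotient is a functional on functions, and [Dproj] gives it a meaning
    only on smooth ones, with value 0 elsewhere. Evaluating it on [f (tbeta q)] therefore requires
    that [f \o gram] have differentiable iterated directional derivatives of every order; this is
    the reason for the calculus developed before any geometry. On the embedded side, tangent vectors
    are velocities of curves, so that even the closure of a tangent set under subtraction is not
    immediate: it is read off from the description of that set as the image of a linear map.
    Finally, inverses, lifts and representatives are all choices. Each of them enters the comparison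
    only through its image under [tbeta] or [Dtbeta], so it is enough that a suitable element
    exists. *)

Section Adjoint.
Context {C : numClosedFieldType} {m n : nat}.
Implicit Types A B : 'M[C]_(m, n).

Lemma adjmxD A B : (A + B)^t* = A^t* + B^t*.
Proof. by rewrite linearD map_mxD. Qed.

Lemma adjmxN A : (- A)^t* = - A^t*.
Proof. by rewrite linearN map_mxN. Qed.

Lemma adjmxB A B : (A - B)^t* = A^t* - B^t*.
Proof. by rewrite adjmxD adjmxN. Qed.

Lemma adjmxZ (a : C) A : (a *: A)^t* = a^* *: A^t*.
Proof. by rewrite linearZ map_mxZ. Qed.

Lemma adjmxM k A (B : 'M[C]_(n, k)) : (A *m B)^t* = B^t* *m A^t*.
Proof. by rewrite trmx_mul map_mxM. Qed.

End Adjoint.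

(** * Real coordinates of complex matrices *)

Section Coordinates.
Context {R : realType} {m n : nat}.
Implicit Types A B : cmat R m n.

Lemma cmat_scaleE (a : R) A : a *: A = (a%:C *: (A : 'M[R[i]]_(m, n)))%R.
Proof. by apply/matrixP => i j; rewrite !mxE. Qed.

Definition re_coord i j : cmat R m n -> R^o := fun A => complex.Re (A i j).
Definition im_coord i j : cmat R m n -> R^o := fun A => complex.Im (A i j).

Fact re_coord_is_linear i j : linear (re_coord i j).
Proof.
move=> a A B; rewrite /re_coord !mxE.
by case: (A i j) => x y; case: (B i j) => x' y' /=; rewrite mul0r subr0.
Qed.

Fact im_coord_is_linear i j : linear (im_coord i j).
Proof.
move=> a A B; rewrite /im_coord !mxE.
by case: (A i j) => x y; case: (B i j) => x' y' /=; rewrite mul0r addr0.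
Qed.

HB.instance Definition _ i j := GRing.isLinear.Build R (cmat R m n) R^o _
  (re_coord i j) (re_coord_is_linear i j).
HB.instance Definition _ i j := GRing.isLinear.Build R (cmat R m n) R^o _
  (im_coord i j) (im_coord_is_linear i j).

Lemma continuous_of_norm_le (W : normedModType R) (L : {linear cmat R m n -> W}) :
  (forall A, `|L A| <= `|A|) -> continuous L.
Proof.
move=> LA; apply/bounded_linear_continuous/linear_boundedP.
near=> r => A; apply: (le_trans (LA A)); rewrite ler_peMl//.
Unshelve. all: by end_near. Qed.

Lemma mx_entry_norm_le (M : 'M[R]_(m, n)) i j : `|M i j| <= `|M|.
Proof.
rewrite [leRHS]mx_normrE.
by rewrite (le_bigmax _ (fun ij : 'I_m * 'I_n => `|M ij.1 ij.2|) (i, j)).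
Qed.

Lemma re_coord_continuous i j : continuous (re_coord i j).
Proof.
apply: continuous_of_norm_le => A; rewrite [leRHS]/Num.norm/= /cmat_norm le_max.
by have := mx_entry_norm_le (re_mx A) i j; rewrite !mxE => ->.
Qed.

Lemma im_coord_continuous i j : continuous (im_coord i j).
Proof.
apply: continuous_of_norm_le => A; rewrite [leRHS]/Num.norm/= /cmat_norm le_max.
by have := mx_entry_norm_le (im_mx A) i j; rewrite !mxE => ->; rewrite orbT.
Qed.

Definition re_unit i j : cmat R m n := delta_mx i j.
Definition im_unit i j : cmat R m n := ('i%C *: delta_mx i j : 'M[R[i]]_(m, n)).

Lemma cmat_decomp A :
  A = \sum_i \sum_j (re_coord i j A *: re_unit i j + im_coord i j A *: im_unit i j).
Proof.
apply/matrixP => i j; rewrite summxE (bigD1 i)//= summxE (bigD1 j)//=.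
rewrite big1 ?big1 ?addr0.
- rewrite !mxE !eqxx /re_coord /im_coord; case: (A i j) => x y /=; simpc.
  by rewrite ?(mul0r, mulr0, mulr1, addr0, add0r, subr0).
- move=> k ki; rewrite summxE big1// => l _.
  by rewrite !mxE eq_sym (negbTE ki)/= !mulr0 addr0.
- by move=> k kj; rewrite !mxE eqxx eq_sym (negbTE kj)/= !mulr0 addr0.
Qed.

Lemma linear_decomp (W : lmodType R) (L : {linear cmat R m n -> W}) A :
  L A = \sum_i \sum_j (re_coord i j A *: L (re_unit i j)
                       + im_coord i j A *: L (im_unit i j)).
Proof.
rewrite [in LHS](cmat_decomp A) linear_sum; apply: eq_bigr => i _.
by rewrite linear_sum; apply: eq_bigr => j _; rewrite linearD !linearZ.
Qed.

Lemma differentiable_sum2 (V W : normedModType R)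
    (a b : 'I_m -> 'I_n -> V -> R^o) (e f : 'I_m -> 'I_n -> W) x :
  (forall i j, differentiable (a i j) x) ->
  (forall i j, differentiable (b i j) x) ->
  differentiable (fun y => \sum_i \sum_j (a i j y *: e i j + b i j y *: f i j)) x.
Proof.
move=> da db; rewrite [X in differentiable X _](_ : _ = \sum_i \sum_j
    ((fun y => a i j y *: e i j) + (fun y => b i j y *: f i j))).
  apply: differentiable_sum => i; apply: differentiable_sum => j.
  by apply: differentiableD; exact: differentiableZl.
apply/funext => y; rewrite fct_sumE; apply: eq_bigr => i _.
by rewrite fct_sumE.
Qed.

(** The real coordinates are bounded by the norm, hence continuous, and [L] is a finite combination
    of them with constant vectors as coefficients. *)
Lemma cmat_linear_continuous (W : normedModType R) (L : {linear cmat R m n -> W}) :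
  continuous L.
Proof.
move=> A; apply/differentiable_continuous; rewrite (funext (linear_decomp L)).
by apply: differentiable_sum2 => i j; apply: linear_differentiable;
  [exact: re_coord_continuous|exact: im_coord_continuous].
Qed.

Lemma cmat_differentiable (V : normedModType R) (F : V -> cmat R m n) x :
  (forall i j, differentiable (re_coord i j \o F) x) ->
  (forall i j, differentiable (im_coord i j \o F) x) ->
  differentiable F x.
Proof.
move=> dre dim; rewrite (funext (fun y => cmat_decomp (F y))).
exact: differentiable_sum2.
Qed.

End Coordinates.

(** * Smoothness through iterated directional derivatives *)

Section SmoothMaps.
Context {R : realType}.

Lemma iter_derive_rcons (V W : normedModType R) (vs : seq V) v (F : V -> W) :
  iter_derive (rcons vs v) F = iter_derive vs ('D_v F).
Proof. by elim: vs => //= w vs ->. Qed.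

(** The last vector of the list is the direction derived first. Peeling the list from that end
    replaces [F] by ['D_v F], so a class of differentiable maps closed under derivation consists of
    smooth maps. *)
Lemma smooth_onP (V W : normedModType R) (U : set V) (F : V -> W) :
  smooth_on U F <->
  (forall x, U x -> differentiable F x) /\ (forall v, smooth_on U ('D_v F)).
Proof.
split=> [sF|[dF sDF] vs].
  split=> [x|v vs]; first exact: (sF [::]).
  by rewrite -iter_derive_rcons; exact: sF.
by elim/last_ind: vs => [//|vs v _]; rewrite iter_derive_rcons; exact: sDF.
Qed.

Lemma smooth_on_sub (V W : normedModType R) (U U' : set V) (F : V -> W) :
  U' `<=` U -> smooth_on U F -> smooth_on U' F.
Proof. by move=> UU' sF vs x /UU'; exact: sF. Qed.

Lemma smooth_cst (V W : normedModType R) (a : W) :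
  smooth_on setT (cst a : V -> W).
Proof.
move=> vs; elim/last_ind: vs a => [|vs v IH] a x _.
  exact: differentiable_cst.
rewrite iter_derive_rcons (_ : 'D_v (cst a) = cst 0); first exact: IH.
by apply/funext => y; rewrite derive_cst.
Qed.

Lemma derive_linear (V W : normedModType R) (L : {linear V -> W}) x v :
  continuous L -> 'D_v L x = L v.
Proof.
by move=> Lc; rewrite deriveE ?diff_lin//; exact: linear_differentiable.
Qed.

Lemma smooth_linear (V W : normedModType R) (L : {linear V -> W}) :
  continuous L -> smooth_on setT L.
Proof.
move=> Lc; apply/smooth_onP; split=> [x _|v]; first exact: linear_differentiable.
rewrite (_ : 'D_v L = cst (L v)); first exact: smooth_cst.
by apply/funext => y; rewrite derive_linear.
Qed.

End SmoothMaps.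

(** * Smoothness of composite maps *)

Section Composition.
Context {R : realType}.

Lemma derive_comp (U V W : normedModType R) (f : V -> W) (G : U -> V) y v :
  differentiable G y -> differentiable f (G y) ->
  'D_v (f \o G) y = 'd f (G y) ('D_v G y).
Proof.
move=> dG df; rewrite (deriveE v dG) (deriveE v (differentiable_comp dG df)).
by rewrite diff_comp.
Qed.

Lemma smooth_linear_comp (U V W : normedModType R) (L : {linear V -> W})
    (G : U -> V) : continuous L ->
  smooth_on setT G -> smooth_on setT (L \o G).
Proof.
move=> Lc sG vs; elim/last_ind: vs G sG => [|vs v IH] G /smooth_onP[dG sDG] x _.
  by apply: differentiable_comp; [exact: dG|exact: linear_differentiable].
rewrite iter_derive_rcons (_ : 'D_v (L \o G) = L \o 'D_v G); first exact: IH.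
apply/funext => y; rewrite derive_comp ?diff_lin//; first exact: dG.
exact: linear_differentiable.
Qed.

Context {V : normedModType R} {m n : nat} (G : V -> cmat R m n).

(* Closed under directional derivatives by the chain and product rules; this is
   what makes the induction on the order of derivation go through. *)
Inductive chain_alg : (V -> R^o) -> Prop :=
| chain_comp f : smooth_on setT f -> chain_alg (f \o G)
| chain_mul (s g : V -> R^o) : smooth_on setT s -> chain_alg g -> chain_alg (s * g)
| chain_add (g h : V -> R^o) : chain_alg g -> chain_alg h -> chain_alg (g + h)
| chain_sum k (h : 'I_k -> V -> R^o) :
    (forall i, chain_alg (h i)) -> chain_alg (\sum_i h i).

Hypothesis smoothG : smooth_on setT G.

Lemma chain_alg_derive g : chain_alg g ->
  (forall x, differentiable g x) /\ (forall v, chain_alg ('D_v g)).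
Proof.
have [dG sDG] := (smooth_onP _ _).1 smoothG.
elim => {g} [f sf|s g ss cg [dg Dg]|g h _ [dg Dg] _ [dh Dh]|k h _ IH].
- have [df sDf] := (smooth_onP _ _).1 sf; split=> [x|v].
    by apply: differentiable_comp; [exact: dG|exact: df].
  (* The chain rule with ['D_v G] expanded in real coordinates: the coefficients are smooth, and the
     other factors are partial derivatives of [f] composed with [G], again generators of the
     algebra. *)
  rewrite (_ : 'D_v _ = \sum_i \sum_j
     ((re_coord i j \o 'D_v G) * ('D_(re_unit i j) f \o G)
      + (im_coord i j \o 'D_v G) * ('D_(im_unit i j) f \o G))).
    apply: chain_sum => i; apply: chain_sum => j.
    apply: chain_add; apply: chain_mul.
    + by apply: smooth_linear_comp => //; exact: re_coord_continuous.
    + exact: chain_comp.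
    + by apply: smooth_linear_comp => //; exact: im_coord_continuous.
    + exact: chain_comp.
  apply/funext => y; rewrite derive_comp; [|exact: dG|exact: df].
  rewrite linear_decomp fct_sumE; apply: eq_bigr => i _.
  rewrite fct_sumE; apply: eq_bigr => j _.
  by rewrite -!deriveE; try exact: df.
- have [ds sDs] := (smooth_onP _ _).1 ss; split=> [x|v].
    by apply: differentiableM => //; exact: ds.
  rewrite (_ : 'D_v _ = s * 'D_v g + 'D_v s * g).
    by apply: chain_add; apply: chain_mul.
  apply/funext => y; rewrite deriveM; try exact: diff_derivable.
    by congr (_ + _); exact: mulrC.
  exact/diff_derivable/ds.
- split=> [x|v]; first exact: differentiableD.
  rewrite (_ : 'D_v _ = 'D_v g + 'D_v h); first exact: chain_add.
  by apply/funext => y; rewrite deriveD//; exact: diff_derivable.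
- split=> [x|v]; first by apply: differentiable_sum => i; exact: (IH i).1.
  rewrite (_ : 'D_v _ = \sum_i 'D_v (h i)).
    by apply: chain_sum => i; exact: (IH i).2.
  apply/funext => y; rewrite derive_sum ?fct_sumE// => i.
  by apply/diff_derivable; exact: (IH i).1.
Qed.

Lemma smooth_comp (f : cmat R m n -> R^o) :
  smooth_on setT f -> smooth_on setT (f \o G).
Proof.
move=> /chain_comp; move: (f \o G) => g cg vs.
elim/last_ind: vs g cg => [|vs v IH] g /chain_alg_derive[dg Dg] x _.
  exact: dg.
by rewrite iter_derive_rcons; exact: IH.
Qed.

End Composition.

(** * Affine maps *)

Section Affine.
Context {R : realType} {V W : normedModType R} (L : {linear V -> W}) (c : W).
Hypothesis Lc : continuous L.

Lemma affine_differentiable y : differentiable (fun y => c + L y) y.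
Proof.
apply: (@differentiableD _ _ _ (cst c) L); first exact: differentiable_cst.
exact: linear_differentiable.
Qed.

Lemma derive_affine y v : 'D_v (fun y => c + L y) y = L v.
Proof.
rewrite (@deriveD _ _ _ (cst c) L); last 2 first.
- exact: derivable_cst.
- exact/diff_derivable/linear_differentiable.
by rewrite derive_cst add0r derive_linear.
Qed.

Lemma smooth_affine : smooth_on setT (fun y => c + L y).
Proof.
apply/smooth_onP; split=> [y _|v]; first exact: affine_differentiable.
rewrite (_ : 'D_v _ = cst (L v)); first exact: smooth_cst.
by apply/funext => y; rewrite derive_affine.
Qed.

End Affine.

(** * The map sending Y to its Gram product, and its derivatives *)

Section Gram.
Context {R : realType} {n p : nat}.
Implicit Types Y A B : cmat R n p.

Definition gram Y : cmat R n n := Y *m Y^t*.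
(** The differential of [gram] at [Y] in the direction [A]. The adjoint makes it linear over the
    reals only, which is why scalars are restricted throughout. *)
Definition sympart Y A : cmat R n n := Y *m A^t* + A *m Y^t*.

Lemma Re_mul_conj (x y : R[i]) :
  complex.Re (x * y^*) = complex.Re x * complex.Re y + complex.Im x * complex.Im y.
Proof. by case: x y => a b [c d] /=; rewrite mulrN opprK. Qed.

Lemma Im_mul_conj (x y : R[i]) :
  complex.Im (x * y^*) = complex.Im x * complex.Re y - complex.Re x * complex.Im y.
Proof. by case: x y => a b [c d] /=; rewrite mulrN addrC. Qed.

Lemma Re_sum (I : Type) (r : seq I) (F : I -> R[i]) :
  complex.Re (\sum_(i <- r) F i) = \sum_(i <- r) complex.Re (F i).
Proof. by apply: big_morph => // -[? ?] []. Qed.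

Lemma Im_sum (I : Type) (r : seq I) (F : I -> R[i]) :
  complex.Im (\sum_(i <- r) F i) = \sum_(i <- r) complex.Im (F i).
Proof. by apply: big_morph => // -[? ?] []. Qed.

Lemma adjmxZ_real (m k : nat) (a : R) (A : 'M[R[i]]_(m, k)) :
  (a%:C *: A)^t* = a%:C *: A^t*.
Proof. by rewrite adjmxZ; congr (_ *: _); exact: conjc_real. Qed.

Lemma sympart_is_linear Y : linear (sympart Y).
Proof.
move=> a A B; rewrite /sympart !cmat_scaleE adjmxD adjmxZ_real.
rewrite mulmxDr mulmxDl -scalemxAr -scalemxAl.
by rewrite [in RHS]scalerDr addrACA.
Qed.
HB.instance Definition _ Y := GRing.isLinear.Build R (cmat R n p) (cmat R n n) _
  (sympart Y) (sympart_is_linear Y).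

Lemma sympartC Y A : sympart Y A = sympart A Y.
Proof. by rewrite /sympart addrC. Qed.

Lemma gramD Y A : gram (Y + A) = gram Y + sympart Y A + gram A.
Proof.
rewrite /gram /sympart adjmxD mulmxDl !mulmxDr !addrA.
by congr (_ + _); rewrite -!addrA; congr (_ + _); exact: addrC.
Qed.

Lemma gramZ (a : R) A : gram (a *: A) = a ^+ 2 *: gram A.
Proof.
rewrite /gram !cmat_scaleE adjmxZ_real -scalemxAr -scalemxAl scalerA.
by rewrite -rmorphM -expr2.
Qed.

(** The real and imaginary parts of each entry of [gram] are quadratic polynomials in the real
    coordinates of its argument. *)
Lemma gram_differentiable (V : normedModType R) (F : V -> cmat R n p) x :
  differentiable F x -> differentiable (gram \o F) x.
Proof.
move=> dF.
have dre i k : differentiable (re_coord i k \o F) x.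
  by apply: differentiable_comp => //; apply/linear_differentiable/re_coord_continuous.
have dim i k : differentiable (im_coord i k \o F) x.
  by apply: differentiable_comp => //; apply/linear_differentiable/im_coord_continuous.
apply: cmat_differentiable => i j.
  rewrite (_ : _ \o _ = \sum_k ((re_coord i k \o F) * (re_coord j k \o F) +
      (im_coord i k \o F) * (im_coord j k \o F))).
    by apply: differentiable_sum => k; apply: differentiableD;
      exact: differentiableM.
  apply/funext => y; rewrite fct_sumE /= /re_coord /gram mxE Re_sum.
  by apply: eq_bigr => k _; rewrite !mxE Re_mul_conj.
rewrite (_ : _ \o _ = \sum_k ((im_coord i k \o F) * (re_coord j k \o F) -
      (re_coord i k \o F) * (im_coord j k \o F))).
  by apply: differentiable_sum => k; apply: differentiableB;
      exact: differentiableM.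
apply/funext => y; rewrite fct_sumE /= /im_coord /gram mxE Im_sum.
by apply: eq_bigr => k _; rewrite !mxE Im_mul_conj.
Qed.

Lemma derive_gram Y A : 'D_A gram Y = sympart Y A.
Proof.
apply/cvg_lim => //.
(* [gram] is quadratic, so away from [h = 0] the difference quotient is exactly this affine function
   of [h]. *)
apply: (@cvg_trans _ ((fun h : R^o => sympart Y A + h *: gram A) @ (0 : R^o)^')).
  apply: near_eq_cvg; near=> h.
  rewrite /= [h *: A + Y]addrC gramD -(addrA (gram Y)) (addrC (gram Y)) addrK.
  have h0 : h != 0 by near: h; exact: nbhs_dnbhs_neq.
  by rewrite gramZ linearZ scalerDr !scalerA mulVf// scale1r expr2 mulrA mulVf// mul1r.
have : (fun h : R^o => sympart Y A + h *: gram A) @ (0 : R^o)^'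
    --> sympart Y A + (0 : R) *: gram A.
  apply: cvgD; first exact: cvg_cst.
  by apply: cvgZr_tmp; exact: cvg_within.
by rewrite scale0r addr0.
Unshelve. all: by end_near. Qed.

(* The first derivatives are real affine in y. *)
Lemma smooth_gram_affine (V : normedModType R) (L : {linear V -> cmat R n p}) Y :
  continuous L -> smooth_on setT (fun y => gram (Y + L y)).
Proof.
move=> Lc; apply/smooth_onP; split=> [y _|v].
  exact/(@gram_differentiable V (fun y => Y + L y))/affine_differentiable.
rewrite (_ : 'D_v _ = fun y => sympart Y (L v) + (sympart (L v) \o L) y).
  apply: smooth_affine => y; apply: continuous_comp; first exact: Lc.
  exact: cmat_linear_continuous.
have dg Z : differentiable gram Z.
  by apply: (@gram_differentiable _ id); exact: ex_diff.
apply/funext => y.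
apply: (etrans (derive_comp v (affine_differentiable Y Lc y) (dg _))).
rewrite (derive_affine Y Lc) -(deriveE _ (dg _)) derive_gram /=.
by rewrite sympartC linearD/= [sympart _ Y]sympartC.
Qed.

Lemma gram_smooth : smooth_on setT gram.
Proof.
have -> : gram = fun y => gram (0 + idfun y).
  by apply/funext => y; rewrite add0r.
by apply: smooth_gram_affine => x; exact: cvg_id.
Qed.

End Gram.

(** * Matrix algebra: invertibility, Cayley transform, symmetrized products *)

Section MatrixAlgebra.
Context {C : numClosedFieldType}.

Lemma mulmx_adj_eq0 (m n : nat) (A : 'M[C]_(m, n)) : A *m A^t* = 0 -> A = 0.
Proof.
move=> AA0; apply/matrixP => i j; rewrite mxE.
have /eqP := congr1 (fun M : 'M[C]_m => M i i) AA0; rewrite !mxE.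
rewrite psumr_eq0 => [/allP/(_ j (mem_index_enum _))/implyP/(_ isT)|k _]; last first.
  by rewrite !mxE mul_conjC_ge0.
by rewrite !mxE mul_conjC_eq0 => /eqP.
Qed.

Lemma row_free_adj_mul (m n : nat) (A : 'M[C]_(m, n)) :
  row_free A -> A *m A^t* \in unitmx.
Proof.
move=> fA; rewrite -row_free_unit; apply: inj_row_free => u uAA.
have /eqP : u *m A = 0.
  apply: mulmx_adj_eq0; rewrite adjmxM mulmxA -(mulmxA u).
  by rewrite uAA mul0mx.
by rewrite mulmx_free_eq0// => /eqP.
Qed.

Lemma rank_adj (m n : nat) (A : 'M[C]_(m, n)) : \rank (A^t*) = \rank A.
Proof. by rewrite mxrank_map mxrank_tr. Qed.

(** Polarization: [u + w] shows that the form at [(u, w)] and at [(w, u)] are opposite, and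
    replacing [w] by ['i *: w] shows that they are equal. *)
Lemma sesquilinear_eq0 (n : nat) (M : 'M[C]_n) :
  (forall u : 'cV_n, u^t* *m M *m u = 0) -> M = 0.
Proof.
move=> M0.
have sym (u w : 'cV_n) : u^t* *m M *m w + w^t* *m M *m u = 0.
  have := M0 (u + w).
  rewrite adjmxD !(mulmxDl, mulmxDr) !M0 add0r addr0.
  by rewrite addrC.
have all0 (u w : 'cV_n) : u^t* *m M *m w = 0.
  have := sym u ('i *: w); rewrite adjmxZ conjCi.
  rewrite -!scalemxAr -!scalemxAl scaleNr -scalerBr => /eqP.
  rewrite scaler_eq0 (negbTE (neq0Ci _))/= subr_eq0 => /eqP uw.
  have /eqP := sym u w; rewrite -uw -mulr2n -scaler_nat scaler_eq0 pnatr_eq0/=.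
  by move/eqP.
apply/matrixP => i j; rewrite mxE.
have := congr1 (fun N : 'M[C]_1 => N 0 0) (all0 (delta_mx i 0) (delta_mx j 0)).
rewrite [RHS]mxE => <-.
have -> : (delta_mx i 0 : 'cV[C]_n)^t* = delta_mx 0 i.
  by apply/matrixP => k l; rewrite !mxE conjC_nat andbC.
by rewrite -rowE -colE !mxE.
Qed.

Section Skew.
Context {p : nat} (Om : 'M[C]_p).
Hypothesis skew : Om^t* = - Om.

(** If the row [u] is in the kernel, its squared norm is the opposite of [u *m Om *m u^t*]; this
    scalar changes sign under the adjoint while the norm does not, so the norm is 0. *)
Lemma unitmx_add_skew : 1%:M + Om \in unitmx.
Proof.
rewrite -row_free_unit; apply: inj_row_free => u.
rewrite mulmxDr mulmx1 => /eqP; rewrite addr_eq0 => /eqP uE.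
have s : u *m u^t* = - (u *m Om *m u^t*) by rewrite {1}uE mulNmx.
have s' : u *m u^t* = u *m Om *m u^t*.
  have := congr1 (fun M : 'M[C]_1 => M^t*) s.
  rewrite adjmxN !adjmxM !trmxCK skew => ->.
  by rewrite mulNmx mulmxN opprK mulmxA.
apply: mulmx_adj_eq0; apply/eqP.
have /eqP : u *m u^t* + u *m u^t* = 0 by rewrite {1}s s' addNr.
by rewrite -mulr2n -scaler_nat scaler_eq0 pnatr_eq0.
Qed.

End Skew.

Section Cayley.
Context {p : nat} (Om : 'M[C]_p).
Hypothesis skew : Om^t* = - Om.

Let Mp : 1%:M + Om \in unitmx := unitmx_add_skew skew.
Let Mm : 1%:M - Om \in unitmx.
Proof. by apply: unitmx_add_skew; rewrite adjmxN skew. Qed.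
Let adjp : (1%:M + Om)^t* = 1%:M - Om.
Proof. by rewrite adjmxD trmx1 map_mx1 skew. Qed.
Let adjm : (1%:M - Om)^t* = 1%:M + Om.
Proof. by rewrite -adjp trmxCK. Qed.

Definition cayley : 'M[C]_p := invmx (1%:M + Om) *m (1%:M - Om).

Lemma mul_cayley : (1%:M + Om) *m cayley = 1%:M - Om.
Proof. by rewrite mulKVmx. Qed.

Lemma cayley_unitary : cayley \is unitarymx.
Proof.
apply/unitarymxP; rewrite adjmxM adjm trmx_inv map_invmx adjp.
rewrite /cayley mulmxA -(mulmxA (invmx _)).
have -> : (1%:M - Om) *m (1%:M + Om) = (1%:M + Om) *m (1%:M - Om).
  rewrite mulmxDr mulmx1 mulmxBr mulmx1 mulmxBl mulmxDl !mul1mx.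
  by rewrite subrKA opprD addrA addrK.
by rewrite mulKmx ?mulmxV.
Qed.

End Cayley.

(** A kernel row satisfies [u = - (u *m t *: N)]. The sum of all [|N k j|] bounds every row sum of
    [N], so the sum [s] of the moduli of the entries of [u] is at most a factor below 1 times
    itself. *)
Lemma unitmx_add_small (p : nat) (N : 'M[C]_p) (t : C) :
  `|t| * (\sum_k \sum_j `|N k j|) < 1 -> 1%:M + t *: N \in unitmx.
Proof.
set c := \sum_k _ => tc; rewrite -row_free_unit; apply: inj_row_free => u.
rewrite mulmxDr mulmx1 => /eqP; rewrite addr_eq0 => /eqP uE.
have c0 k : 0 <= \sum_j `|N k j| by apply: sumr_ge0.
pose s := \sum_j `|u 0 j|.
have s0 : 0 <= s by apply: sumr_ge0.
have ss : s <= `|t| * c * s.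
  rewrite {1}/s (eq_bigr (fun j => `|t| * `|\sum_k u 0 k * N k j|)); last first.
    by move=> j _; rewrite {1}uE -scalemxAr !mxE normrN normrM.
  rewrite -mulr_sumr -mulrA ler_wpM2l//.
  apply: (@le_trans _ _ (\sum_j \sum_k `|u 0 k| * `|N k j|)).
    apply: ler_sum => j _; apply: (le_trans (ler_norm_sum _ _ _)).
    by apply: ler_sum => k _; rewrite normrM.
  rewrite exchange_big/= mulr_sumr; apply: ler_sum => k _.
  rewrite -mulr_sumr mulrC ler_wpM2r// /c [leRHS](bigD1 k)//= lerDl.
  exact: sumr_ge0.
have s00 : s = 0.
  apply/eqP; rewrite eq_le s0 andbT; apply: contraTT tc => /negP sp.
  have {}sp : 0 < s by rewrite lt_neqAle s0 andbT; apply: contra_notN sp => /eqP <-.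
  rewrite -real_leNgt ?real1 ?ger0_real// ?mulr_ge0 ?sumr_ge0//.
  by rewrite -(ler_pM2r sp) mul1r.
apply/matrixP => i j; rewrite ord1 mxE; apply/eqP; rewrite -normr_eq0.
move/eqP: s00; rewrite psumr_eq0//.
by move/allP/(_ j (mem_index_enum _))/implyP/(_ isT).
Qed.

Section FullRank.
Context {n p : nat} (Y : 'M[C]_(n, p)).
Hypothesis rY : \rank Y = p.

Lemma row_free_adj : row_free (Y^t*).
Proof. by rewrite /row_free rank_adj rY. Qed.

Lemma adj_mul_unit : Y^t* *m Y \in unitmx.
Proof. by have := row_free_adj_mul row_free_adj; rewrite trmxCK. Qed.

Definition gram_inv := invmx (Y^t* *m Y).

Lemma gram_inv_adj : gram_inv^t* = gram_inv.
Proof.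
by rewrite /gram_inv trmx_inv map_invmx adjmxM trmxCK.
Qed.

Lemma gram_invl (q : nat) (Z : 'M[C]_(p, q)) : gram_inv *m (Y^t* *m (Y *m Z)) = Z.
Proof. by rewrite (mulmxA _ Y) mulKmx// adj_mul_unit. Qed.

Lemma gram_invl1 : gram_inv *m (Y^t* *m Y) = 1%:M.
Proof. by rewrite mulVmx// adj_mul_unit. Qed.

Lemma gram_invr1 : Y^t* *m Y *m gram_inv = 1%:M.
Proof. by rewrite mulmxV// adj_mul_unit. Qed.

(** With [P = 1 - K] the orthogonal projector on the columns of [Y], the hypothesis reads V = PV +
    VP - PVP. The factor 1/2 in the witness makes [A *m Y^t*] equal to VP - PVP/2, so that it and
    its adjoint share the term PVP evenly. *)
Lemma sympart_onto (V : 'M[C]_n) (K := 1%:M - Y *m gram_inv *m Y^t*) :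
  V^t* = V -> K *m V *m K = 0 -> exists A, V = Y *m A^t* + A *m Y^t*.
Proof.
move=> Vh; set P := Y *m gram_inv *m Y^t* in K *.
have Ph : P^t* = P by rewrite /P !adjmxM trmxCK gram_inv_adj mulmxA.
rewrite /K mulmxBl mul1mx !mulmxBr !mulmx1 => KVK.
have AE : (V - 2^-1 *: (P *m V)) *m Y *m gram_inv *m Y^t*
    = V *m P - 2^-1 *: (P *m V *m P).
  by rewrite -!mulmxA (mulmxA Y) -/P mulmxBl -scalemxAl !mulmxA.
exists ((V - 2^-1 *: (P *m V)) *m Y *m gram_inv); rewrite AE.
rewrite -[X in X + _]trmxCK [in X in X + _]adjmxM trmxCK AE.
rewrite adjmxB adjmxZ (adjmxM V P) (adjmxM _ P) (adjmxM P V) Vh Ph.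
rewrite fmorphV/= conjC_nat (mulmxA P).
rewrite addrACA -opprD -scalerDl.
have -> : 2^-1 + 2^-1 = 1 :> C by rewrite [RHS]splitr !mul1r.
rewrite scale1r; move: KVK; rewrite mulmxBl => /subr0_eq/eqP.
by rewrite subr_eq => /eqP VE; rewrite [LHS]VE -[RHS]addrA [RHS]addrC.
Qed.

Lemma proj_compl_mul : (1%:M - Y *m gram_inv *m Y^t*) *m Y = 0.
Proof.
by rewrite mulmxBl mul1mx -!mulmxA gram_invl1 mulmx1 subrr.
Qed.

End FullRank.

End MatrixAlgebra.

(** * Factorization of positive semidefinite matrices *)

Section PsdFactor.
Context {C : numClosedFieldType}.

(** The spectral theorem diagonalizes [X]; evaluating the form at the i-th eigenvector gives the
    i-th eigenvalue, which is therefore nonnegative and has a real square root. *)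
Lemma psd_factor_square (n : nat) (X : 'M[C]_n) :
  X \is hermsymmx -> (forall u : 'cV_n, 0 <= (u^t* *m X *m u) 0 0) ->
  exists Z : 'M[C]_n, X = Z *m Z^t*.
Proof.
move=> Xh Xp; have /orthomx_spectralP XE := hermitian_normalmx Xh.
set P := spectralmx X in XE; set d := spectral_diag X in XE.
have UP : P \is unitarymx := spectral_unitarymx X.
rewrite (invmx_unitary UP) in XE.
have d0 i : 0 <= d 0 i.
  have := Xp (P^t* *m delta_mx i 0); rewrite adjmxM trmxCK {1}XE.
  have -> : (delta_mx i 0 : 'cV[C]_n)^t* = delta_mx 0 i.
    by apply/matrixP => k l; rewrite !mxE conjC_nat andbC.
  rewrite !mulmxA -(mulmxA _ P (P^t*)) (unitarymxP UP) mulmx1.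
  rewrite -(mulmxA _ P (P^t*)) (unitarymxP UP) mulmx1.
  by rewrite -rowE -colE !mxE eqxx mulr1n.
exists (P^t* *m diag_mx (\row_i sqrtC (d 0 i))).
rewrite adjmxM trmxCK tr_diag_mx map_diag_mx.
rewrite [LHS]XE !mulmxA -(mulmxA (P^t*)) mulmx_diag.
congr (_ *m diag_mx _ *m _); apply/rowP => i; rewrite !mxE.
have sC : ((sqrtC (d 0 i))^*)%R = sqrtC (d 0 i) by rewrite geC0_conj ?sqrtC_ge0.
by rewrite [X in _ * X]sC -expr2 sqrtCK.
Qed.

(* Conjugating by an orthonormal basis U of the row space of X reduces to the
   square case. *)
Lemma psd_factor (n : nat) (X : 'M[C]_n) :
  X \is hermsymmx -> (forall u : 'cV_n, 0 <= (u^t* *m X *m u) 0 0) ->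
  exists Y : 'M[C]_(n, \rank X), X = Y *m Y^t*.
Proof.
move=> Xh Xp.
have Xadj : X^t* = X by move/is_hermitianmxP: Xh; rewrite expr0 scale1r => <-.
pose U := schmidt (row_base X).
have UU : U \is unitarymx by apply: schmidt_unitarymx; exact: rank_leq_col.
have /submxP[W XW] : (X <= U)%MS.
  by apply: submx_trans (schmidt_sub _); rewrite eq_row_base.
have XU : X *m (U^t* *m U) = X.
  have -> : X *m (U^t* *m U) = W *m (U *m U^t*) *m U.
    by rewrite {1}[X in X *m _]XW !mulmxA.
  by rewrite (unitarymxP UU) mulmx1 -XW.
have [Z XZ] : exists Z : 'M[C]_(\rank X), U *m X *m U^t* = Z *m Z^t*.
  apply: psd_factor_square => [|u].
    apply/is_hermitianmxP; rewrite expr0 scale1r.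
    by rewrite !adjmxM trmxCK Xadj mulmxA.
  by have := Xp (U^t* *m u); rewrite adjmxM trmxCK !mulmxA.
exists (U^t* *m Z); rewrite adjmxM trmxCK mulmxA -(mulmxA _ Z) -XZ.
rewrite !mulmxA -(mulmxA _ (U^t*) U) -(mulmxA _ X) XU.
by have := congr1 (fun M : 'M[C]_n => M^t* ) XU; rewrite !adjmxM trmxCK Xadj => ->.
Qed.

End PsdFactor.

(** * Points and tangent vectors of the embedded manifold *)

Section PsdManifold.
Context {R : realType} {n p : nat}.
Implicit Types (Y A : cmat R n p) (X V Z : cmat R n n).

Lemma gram_psd_rank Y : fullrank Y -> psd_rank R n p (gram Y).
Proof.
move=> rY; split.
- by apply/is_hermitianmxP; rewrite expr0 scale1r /gram adjmxM trmxCK.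
- move=> u; rewrite /gram mulmxA -mulmxA -{2}[u]trmxCK -adjmxM.
  by rewrite mxE sumr_ge0// => k _; rewrite !mxE mul_conjC_ge0.
- by rewrite /gram mxrankMfree// row_free_adj.
Qed.

Lemma psd_rank_gram X : psd_rank R n p X ->
  exists2 Y : cmat R n p, fullrank Y & gram Y = X.
Proof.
case=> Xh Xp rX; have [Y XY] := psd_factor Xh Xp.
rewrite rX in Y XY; exists Y => //.
apply/eqP; rewrite /fullrank/= eqn_leq rank_leq_col/=.
by rewrite -{1}rX [X in (\rank X <= _)%N]XY mxrankM_maxl.
Qed.

(** Packaged as a linear map so that the results on affine maps apply to the curve [Y + t *: A]. *)
Definition line A : R^o -> cmat R n p := fun t => t *: A.
Fact line_is_linear A : linear (line A).
Proof. by move=> a s t; rewrite /line scalerDl scalerA. Qed.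
HB.instance Definition _ A := GRing.isLinear.Build R R^o (cmat R n p) _
  (line A) (line_is_linear A).

(** The left inverse of [Y] maps [Y + t *: A] to a small perturbation of the identity. The bound is
    a product rather than a quotient because [c] may be 0. *)
Lemma fullrank_near Y A : fullrank Y -> exists2 c : R, 0 <= c &
  forall t, `|t| * c < 1 -> fullrank (Y + t *: A).
Proof.
move=> rY; pose N := gram_inv Y *m Y^t* *m A.
pose c := \sum_k \sum_j `|N k j|.
have c0 : 0 <= c by apply: sumr_ge0 => k _; apply: sumr_ge0.
have cR : c = (complex.Re c)%:C by rewrite RRe_real// ger0_real.
exists (complex.Re c); first by rewrite -ler0c -cR.
move=> t tc; have Nu : 1%:M + t%:C *: N \in unitmx.
  apply: unitmx_add_small; rewrite -/c cR.
  by rewrite normc_def/= expr0n/= addr0 sqrtr_sqr -rmorphM ltcR.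
apply/eqP; rewrite /fullrank/= eqn_leq rank_leq_col/=.
have : \rank (gram_inv Y *m Y^t* *m (Y + t *: A)) = p.
  rewrite cmat_scaleE mulmxDr -scalemxAr -/N -mulmxA gram_invl1//.
  by apply/eqP; rewrite -row_free_unit in Nu.
by move=> {1}<-; exact: mxrankM_maxr.
Qed.

Lemma sympart_tangent Y A : fullrank Y ->
  tangent (psd_rank R n p) (gram Y) (sympart Y A).
Proof.
move=> rY; have [c c0 cY] := fullrank_near A rY.
have Lc : continuous (line A) by exact: scalel_continuous.
have sc := smooth_gram_affine Y Lc.
(* The radius must be positive and finite even when [c = 0], hence [c + 1]. *)
have d1 : 0 < 1 / (c + 1) by rewrite divr_gt0 ?ltr_wpDl.
exists (ball (0 : R^o) (1 / (c + 1))), (fun t => gram (Y + line A t)); split.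
- exact: ball_open.
- exact: ballxx.
- exact: (smooth_on_sub _ sc).
- move=> t; rewrite -ball_normE /ball_/= sub0r normrN => tc.
  apply/gram_psd_rank/cY; move: tc; rewrite ltr_pdivlMr ?ltr_wpDl// mulrDr mulr1.
  by apply: le_lt_trans; rewrite lerDl.
- rewrite linear0 addr0; split=> //.
  have [dc _] := (smooth_onP _ _).1 sc.
  apply: DeriveDef; first exact/diff_derivable/dc.
  have dg B : differentiable (@gram R n p) B.
    by apply: (@gram_differentiable _ _ _ _ id); exact: ex_diff.
  apply: (etrans (derive_comp _ (affine_differentiable Y Lc _) (dg _))).
  rewrite (derive_affine Y Lc) -(deriveE _ (dg _)) derive_gram.
  by rewrite linear0 addr0; congr (sympart _ _); exact: scale1r.
Qed.

(** Fermat's rule along a curve with velocity [V]: [l \o c] is minimal at the interior time 0, where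
    its derivative is [l V]. *)
Lemma tangent_min (S : set (cmat R n n)) X V (l : {linear cmat R n n -> R^o}) :
  (forall Z, S Z -> l X <= l Z) -> tangent S X V -> l V = 0.
Proof.
move=> lmin [I [c [oI I0 sc cS [c0 dc]]]].
have lc : continuous l by exact: cmat_linear_continuous.
have [dcI _] := (smooth_onP _ _).1 sc.
have [e /= e0 eI] : exists2 e : R, 0 < e & ball (0 : R^o) e `<=` I.
  by have /nbhs_ballP[e /= e0 eI] := open_nbhs_nbhs (conj oI I0); exists e.
have eI' t : t \in `]- e, e[ -> I t.
  rewrite in_itv/= => te; apply: eI.
  by rewrite -ball_normE /ball_/= sub0r normrN ltr_norml.
have dl t : I t -> differentiable (l \o c) t.
  move=> It; apply: differentiable_comp; first exact: dcI.
  exact: linear_differentiable.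
have : is_derive (0 : R) 1 (l \o c : R -> R) 0.
  apply: (@derive1_at_min _ _ (- e) e).
  - by rewrite (le_trans _ (ltW e0))// oppr_le0 ltW.
  - by move=> t /eI' It; exact/diff_derivable/dl.
  - by rewrite in_itv/= oppr_lt0 e0.
  - by move=> t /eI' It; rewrite /= c0; exact/lmin/cS.
move=> [_ <-].
rewrite (derive_comp (1 : R^o) (dcI _ I0) (linear_differentiable _ lc)).
by rewrite diff_lin// (@derive_val _ _ _ _ _ _ _ dc).
Qed.

Lemma tangent_const (S : set (cmat R n n)) X V (l : {linear cmat R n n -> R^o}) :
  (forall Z, S Z -> l Z = l X) -> tangent S X V -> l V = 0.
Proof. by move=> lS; apply: tangent_min => Z /lS ->. Qed.

Definition quad_form (u : 'cV[R[i]]_n) : cmat R n n -> R^o :=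
  fun X => complex.Re ((u^t* *m X *m u) 0 0).
Fact quad_form_is_linear u : linear (quad_form u).
Proof.
move=> a A B; rewrite /quad_form cmat_scaleE mulmxDr mulmxDl.
rewrite -scalemxAr -scalemxAl !mxE.
by case: (\sum_k _) (\sum_k _) => x y [z t]/=; rewrite mul0r subr0.
Qed.
HB.instance Definition _ u := GRing.isLinear.Build R (cmat R n n) R^o _
  (quad_form u) (quad_form_is_linear u).

Lemma psd_rank_adj X : psd_rank R n p X -> X^t* = X.
Proof. by case=> /is_hermitianmxP; rewrite expr0 scale1r => <-. Qed.

Lemma tangent_adj X V : psd_rank R n p X -> tangent (psd_rank R n p) X V -> V^t* = V.
Proof.
move=> SX TV.
have coord Z : psd_rank R n p Z -> forall i j, (Z i j)^* = Z j i.
  by move=> /psd_rank_adj ZE i j; rewrite -[in RHS]ZE !mxE.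
apply/matrixP => i j; rewrite !mxE.
(* A matrix is Hermitian when these real linear functionals, and those of [imV], vanish; they are
   constant on the manifold, hence zero on its velocities. *)
have reV : (re_coord i j \- re_coord j i) V = 0.
  apply: (tangent_const _ TV) => Z SZ /=.
  rewrite /re_coord -(coord _ SZ i j) -(coord _ SX i j).
  by case: (Z i j) (X i j) => ? ? [? ?]/=; rewrite !subrr.
have imV : (im_coord i j \+ im_coord j i) V = 0.
  apply: (tangent_const _ TV) => Z SZ /=.
  rewrite /im_coord -(coord _ SZ i j) -(coord _ SX i j).
  by case: (Z i j) (X i j) => ? ? [? ?]/=; rewrite !subrr.
move: reV imV; rewrite /= /re_coord /im_coord.
case: (V i j) (V j i) => a b [c d] /= /subr0_eq -> /eqP.
by rewrite addr_eq0 => /eqP ->.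
Qed.

(* A curve of positive semidefinite matrices minimizes u^* X u at time 0 when
   X u = 0; hence its velocity has no component in ker X x ker X. *)
Lemma tangent_psdP Y V : fullrank Y ->
  tangent (psd_rank R n p) (gram Y) V <-> exists A, V = sympart Y A.
Proof.
move=> rY; split=> [TV|[A ->]]; last exact: sympart_tangent.
have Vh := tangent_adj (gram_psd_rank rY) TV.
apply: sympart_onto => //; set K := 1%:M - _.
have KY : K *m Y = 0 by exact: proj_compl_mul.
have Kh : K^t* = K.
  rewrite /K adjmxB trmx1 map_mx1 !adjmxM trmxCK gram_inv_adj mulmxA.
  by [].
apply: sesquilinear_eq0 => u.
pose w := K *m u.
have q0 : quad_form w V = 0.
  apply: (tangent_min _ TV) => Z [_ Zp _].
  have qY : quad_form w (gram Y) = 0.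
    rewrite /quad_form /w adjmxM Kh /gram !mulmxA -(mulmxA (u^t*) K Y) KY.
    by rewrite mulmx0 !mul0mx mxE.
  by rewrite [leLHS]qY; have := Zp w; rewrite lecE => /andP[_].
have wE : u^t* *m (K *m V *m K) *m u = w^t* *m V *m w.
  by rewrite /w adjmxM Kh !mulmxA.
clearbody w; rewrite wE; apply/matrixP => i j; rewrite !ord1 [RHS]mxE.
(* [quad_form] sees only the real part; the imaginary part vanishes because [V] is Hermitian. *)
have : ((w^t* *m V *m w) 0 0)^* = (w^t* *m V *m w) 0 0.
  have: (w^t* *m V *m w)^t* = w^t* *m V *m w.
    by rewrite !adjmxM trmxCK Vh mulmxA.
  by move/(congr1 (fun M : 'M[R[i]]_1 => M 0 0)); rewrite mxE [in LHS]mxE.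
move: q0; rewrite /quad_form; case: ((w^t* *m V *m w) 0 0) => a b /= -> [].
by move/eqP; rewrite eq_sym -addr_eq0 -mulr2n mulrn_eq0/= => /eqP ->.
Qed.

End PsdManifold.

(** The difference quotients coincide, so no differentiability enters. It serves to change
    representatives and to reverse a vertical direction. *)
Lemma derive_eq_line (R : realType) (V W : normedModType R) (F G : V -> W)
    (a b v w : V) :
  (forall t : R, F (t *: v + a) = G (t *: w + b)) -> 'D_v F a = 'D_w G b.
Proof.
move=> FG; have FG0 : F a = G b by have := FG 0; rewrite !scale0r !add0r.
rewrite /derive (_ : (fun t => _) =
  (fun t : R => t^-1 *: ((G \o shift b) (t *: w) - G b)))//.
by apply/funext => t /=; rewrite FG FG0.
Qed.

(** * The real inner product *)

Section InnerProduct.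
Context {R : realType} {m n : nat}.
Implicit Types A B D : cmat R m n.

Lemma innerE A B : inner A B = \sum_j \sum_i
  (re_coord i j A * re_coord i j B + im_coord i j A * im_coord i j B).
Proof.
rewrite /inner /mxtrace Re_sum; apply: eq_bigr => j _.
rewrite mxE Re_sum; apply: eq_bigr => i _.
by rewrite !mxE [X in complex.Re X]mulrC Re_mul_conj mulrC [X in _ + X]mulrC.
Qed.

Lemma innerBl A B D : inner (A - B) D = inner A D - inner B D.
Proof.
rewrite !innerE -sumrB; apply: eq_bigr => j _.
rewrite -sumrB; apply: eq_bigr => i _; rewrite !linearB/= !mulrBl opprD.
exact: addrACA.
Qed.

Lemma inner0r A : inner A 0 = 0.
Proof. by rewrite /inner mulmx0 mxtrace0. Qed.

Lemma inner0l A : inner 0 A = 0.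
Proof. by rewrite -(subrr A) innerBl subrr. Qed.

Lemma inner_eq0 A : inner A A = 0 -> A = 0.
Proof.
rewrite innerE => /eqP; rewrite psumr_eq0 => [/allP A0|j _]; last first.
  by apply: sumr_ge0 => i _; rewrite addr_ge0// -expr2 sqr_ge0.
apply/matrixP => i j; rewrite mxE.
have := A0 j (mem_index_enum _).
rewrite implyTb psumr_eq0 => [/allP Aj|k _]; last first.
  by rewrite addr_ge0// -expr2 sqr_ge0.
have := Aj i (mem_index_enum _); rewrite implyTb -!expr2 paddr_eq0 ?sqr_ge0//.
rewrite !sqrf_eq0 /re_coord /im_coord; case: (A i j) => x y /=.
by move=> /andP[/eqP -> /eqP ->].
Qed.

End InnerProduct.

(** * Horizontal lifts, metric and gradient on the quotient *)

Section QuotientGeometry.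
Context {R : realType} {n p : nat}.
Implicit Types (Y A B : cmat R n p) (q : quot R n p).

Lemma sympart_skew Y (Om : 'M[R[i]]_p) : Om^t* = - Om -> sympart Y (Y *m Om) = 0.
Proof.
by move=> sk; rewrite /sympart adjmxM sk mulNmx mulmxN mulmxA addNr.
Qed.

Lemma vproj_vertical Y A :
  exists2 Om : 'M[R[i]]_p, Om^t* = - Om & vproj Y A = Y *m Om.
Proof.
exists (2^-1 *: (gram_inv Y *m Y^t* *m A - A^t* *m Y *m gram_inv Y)) => //.
rewrite adjmxZ adjmxB !adjmxM !trmxCK gram_inv_adj -scalerN opprB !mulmxA.
by congr (_ *: _); rewrite fmorphV/= conjC_nat.
Qed.

(** The two terms averaged in [vproj] are [Om] and [- Om^t*], which agree for skew [Om]. *)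
Lemma vproj_skew Y (Om : 'M[R[i]]_p) : fullrank Y -> Om^t* = - Om ->
  vproj Y (Y *m Om) = Y *m Om.
Proof.
move=> rY sk; rewrite /vproj -/(gram_inv Y) adjmxM sk -!mulmxA gram_invl//.
rewrite (mulmxA (Y^t*)) gram_invr1// mulmx1 opprK -mulr2n.
rewrite -[X in _ *: X]scaler_nat scalerA.
by rewrite mulVf ?scale1r// pnatr_eq0.
Qed.

Lemma vproj_idem Y A : fullrank Y -> vproj Y (vproj Y A) = vproj Y A.
Proof. by move=> rY; have [Om sk ->] := vproj_vertical Y A; exact: vproj_skew. Qed.

Lemma vprojB Y A B : vproj Y (A - B) = vproj Y A - vproj Y B.
Proof.
rewrite /vproj adjmxB -mulmxBr -scalerBr; congr (_ *m (_ *: _)).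
by rewrite mulmxBr !mulmxBl !opprB addrACA [RHS]addrACA; congr (_ + _); rewrite addrC.
Qed.

Lemma g3E Y A B : g3 Y A B = inner (sympart Y A) (sympart Y B)
  + inner (vproj Y A *m Y^t* : cmat R n n) (vproj Y B *m Y^t*).
Proof. by []. Qed.

(** Horizontality is tested against the vertical vector [vproj Y A] itself: [sympart Y] kills it,
    and what remains of [g3] is the squared norm of the matrix in question. *)
Lemma horizontal_vproj Y A : fullrank Y -> horizontal Y A ->
  (vproj Y A *m Y^t* : cmat R n n) = 0.
Proof.
move=> rY hA; have [Om sk vE] := vproj_vertical Y A; apply: inner_eq0.
have := hA (vproj Y A); rewrite g3E.
have -> : sympart Y (vproj Y A) = 0 by rewrite vE sympart_skew.
rewrite inner0r add0r.
rewrite vproj_idem//; apply.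
by exists Om.
Qed.

Lemma g3_horizontal Y A B : fullrank Y -> horizontal Y A ->
  g3 Y A B = inner (sympart Y A) (sympart Y B).
Proof.
move=> rY hA.
have vA (W : cmat R n n) : inner (vproj Y A *m Y^t* : cmat R n n) W = 0.
  by rewrite (horizontal_vproj rY hA) inner0l.
exact: (etrans (congr1 (+%R _) (vA _)) (addr0 _)).
Qed.

Lemma horizontal_sub_vproj Y A : fullrank Y -> horizontal Y (A - vproj Y A).
Proof.
move=> rY B [Om sk <-]; rewrite g3E sympart_skew// inner0r add0r.
rewrite vprojB vproj_idem// subrr mul0mx; exact: inner0l.
Qed.

Lemma qproj_unitary Y (O : 'M[R[i]]_p) : O \is unitarymx ->
  qproj (Y *m O : cmat R n p) = qproj Y.
Proof.
move=> UO; apply/seteqP; split => _ [U /= UU <-].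
  by exists (O *m U); rewrite /= ?mulmxA// mul_unitarymx.
exists (O^t* *m U); first by rewrite /= mul_unitarymx ?trmxC_unitary.
by rewrite -!mulmxA (mulmxA O) (unitarymxP UO) mul1mx.
Qed.

Lemma Dproj_unitary Y A (O : 'M[R[i]]_p) : O \is unitarymx ->
  Dproj (Y *m O : cmat R n p) (A *m O : cmat R n p) = Dproj Y A.
Proof.
move=> UO; apply/funext => phi; rewrite /Dproj; case: asboolP => // _.
apply: derive_eq_line => t /=.
have -> : (t *: (A *m O : cmat R n p) + Y *m O : cmat R n p) = (t *: A + Y) *m O.
  by rewrite mulmxDl !cmat_scaleE -scalemxAl.
by rewrite (qproj_unitary _ UO).
Qed.

Section DifferentialProjection.
Variable Y : cmat R n p.
Hypothesis rY : fullrank Y.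

Let diffY (phi : quot R n p -> R) : smooth_quot phi ->
  differentiable (phi \o @qproj R n p : cmat R n p -> R^o) Y.
Proof. by move=> /(_ [::] Y rY). Qed.

Lemma DprojP a A B : Dproj Y (a *: A + B) = a *: Dproj Y A + Dproj Y B.
Proof.
apply/funext => phi.
transitivity (a *: Dproj Y A phi + Dproj Y B phi) => //; rewrite /Dproj.
case: asboolP => [/diffY d|_]; last by rewrite scaler0 addr0.
by rewrite !deriveE// linearD linearZ.
Qed.

(* Y + t Y Om and Y - t Y Om lie in the same orbit, by the Cayley transform of
   t Om; so phi is even along the line Y + t Y Om. *)
Lemma Dproj_skew (Om : 'M[R[i]]_p) : Om^t* = - Om -> Dproj Y (Y *m Om) = 0.
Proof.
move=> sk; apply/funext => phi; rewrite /Dproj.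
case: asboolP => [/diffY d|//].
set F := phi \o _; set A : cmat R n p := Y *m Om.
have even (t : R) : F (t *: A + Y) = F (t *: - A + Y).
  rewrite /F /=; congr phi.
  have skt : (t%:C *: Om)^t* = - (t%:C *: Om) by rewrite adjmxZ_real sk scalerN.
  have E : (t *: - A + Y : cmat R n p) = (t *: A + Y) *m cayley (t%:C *: Om).
    have -> : (t *: A + Y : cmat R n p) = Y *m (1%:M + t%:C *: Om).
      by rewrite mulmxDr mulmx1 -scalemxAr cmat_scaleE addrC.
    rewrite -mulmxA mul_cayley// mulmxBr mulmx1 -scalemxAr scalerN cmat_scaleE.
    by rewrite addrC.
  by rewrite E qproj_unitary// cayley_unitary.
have DN : 'D_A F Y = 'D_(- A) F Y.
  exact: derive_eq_line.
have : 'D_A F Y + 'D_A F Y = 0 by rewrite {2}DN !deriveE// linearN subrr.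
by move/eqP; rewrite -mulr2n mulrn_eq0 => /eqP.
Qed.

Lemma Dproj_hlift A : horizontal Y (hlift Y (Dproj Y A)) /\
  Dproj Y (hlift Y (Dproj Y A)) = Dproj Y A.
Proof.
apply: (@xgetPex _ 0 [set B | horizontal Y B /\ Dproj Y B = Dproj Y A]).
exists (A - vproj Y A); split.
  exact: horizontal_sub_vproj.
have [Om sk ->] := vproj_vertical Y A.
by rewrite addrC -scaleN1r DprojP Dproj_skew// scaler0 add0r.
Qed.

End DifferentialProjection.

Lemma qproj_repr Y (Z : cmat R n p) : fullrank Y -> qproj Y Z ->
  fullrank Z /\ qproj Z = qproj Y.
Proof.
move=> rY [U /= UU <-]; split; last exact: qproj_unitary.
by rewrite /fullrank/= mxrankMfree// row_free_unit unitarymx_unit.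
Qed.

Lemma quotient_repr q : quotient_set q ->
  fullrank (orbit_repr q) /\ qproj (orbit_repr q) = q.
Proof.
move=> [Y rY <-]; apply: qproj_repr => //.
by apply: (xgetPex 0); exists Y; exact: qproj_id.
Qed.

Lemma qproj_fullrank Y : quotient_set (qproj Y) -> fullrank Y.
Proof.
move=> [Z rZ ZY]; apply: (qproj_repr rZ _).1.
by rewrite ZY; exact: qproj_id.
Qed.

Lemma tbeta_gram Y : tbeta (qproj Y) = gram Y.
Proof. exact: tbetaE. Qed.

(** [tangent_quot] allows any representative of the orbit; a unitary factor carries both the
    representative and the direction over to the given [Y]. *)
Lemma tangent_quotP Y : fullrank Y -> forall xi,
  tangent_quot (qproj Y) xi <-> exists A, xi = Dproj Y A.
Proof.
move=> rY xi; split=> [[Z [A [rZ ZY ->]]]|[A ->]]; last by exists Y, A.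
have [U /= UU <-] : qproj Z Y by rewrite ZY; exact: qproj_id.
by exists (A *m U); rewrite Dproj_unitary.
Qed.

(** Discharges the smoothness test in [Dproj], both for the cost and for the real coordinates of
    [tbeta] from which [Dtbeta] is built. *)
Lemma smooth_quot_tbeta (f : cmat R n n -> R^o) : smooth_on setT f ->
  smooth_quot (fun q => f (tbeta q)).
Proof.
move=> sf; apply: (@smooth_on_sub _ _ _ setT) => //.
rewrite (_ : _ \o _ = f \o gram); last by apply/funext => Y /=; rewrite tbeta_gram.
by apply: smooth_comp => //; exact: gram_smooth.
Qed.

Lemma Dproj_tbeta (f : cmat R n n -> R^o) Y A : smooth_on setT f ->
  Dproj Y A (fun q => f (tbeta q)) = 'D_(sympart Y A) f (gram Y).
Proof.
move=> sf; rewrite /Dproj asboolT; last exact: smooth_quot_tbeta.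
rewrite (_ : _ \o _ = f \o gram); last by apply/funext => Z /=; rewrite tbeta_gram.
have [df _] := (smooth_onP _ _).1 sf.
have [dg _] := (smooth_onP _ _).1 (@gram_smooth R n p).
rewrite (derive_comp A (dg Y I) (df _ I)) derive_gram deriveE//.
exact: df.
Qed.

Lemma Dtbeta_Dproj Y A : Dtbeta (Dproj Y A) = sympart Y A.
Proof.
apply/matrixP => i j; rewrite mxE.
have rc := @re_coord_continuous R n n i j.
have ic := @im_coord_continuous R n n i j.
rewrite (Dproj_tbeta _ _ (smooth_linear rc)) (derive_linear _ _ rc).
rewrite (Dproj_tbeta _ _ (smooth_linear ic)) (derive_linear _ _ ic).
by apply/eqP; rewrite eq_complex !eqxx.
Qed.

Fact Dtbeta_is_linear : linear (@Dtbeta R n p).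
Proof.
move=> a xi zeta; apply/matrixP => i j; rewrite !mxE.
by apply/eqP; rewrite eq_complex /= mul0r mul0r subr0 addr0 !eqxx.
Qed.
HB.instance Definition _ := GRing.isLinear.Build R (@qvec R n p) (cmat R n n) _
  (@Dtbeta R n p) Dtbeta_is_linear.

Lemma tangent_quot_linear q (a : R) xi zeta : quotient_set q ->
  tangent_quot q xi -> tangent_quot q zeta -> tangent_quot q (a *: xi + zeta).
Proof.
move=> [Y rY <-] /(tangent_quotP rY)[A ->] /(tangent_quotP rY)[B ->].
by apply/(tangent_quotP rY); exists (a *: A + B); rewrite DprojP.
Qed.

Lemma tangent_quot0 q : quotient_set q -> tangent_quot q 0.
Proof.
move=> [Y rY <-]; apply/(tangent_quotP rY); exists 0.
have := Dproj_skew rY (_ : (0 : 'M[R[i]]_p)^t* = - 0); rewrite mulmx0 => -> //.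
by rewrite trmx0 map_mx0 oppr0.
Qed.

Lemma Dtbeta_tangent q xi : quotient_set q -> tangent_quot q xi ->
  tangent (psd_rank R n p) (tbeta q) (Dtbeta xi).
Proof.
move=> [Y rY <-] /(tangent_quotP rY)[A ->].
by rewrite Dtbeta_Dproj tbeta_gram; exact: sympart_tangent.
Qed.

Lemma Dtbeta_onto q V : quotient_set q ->
  tangent (psd_rank R n p) (tbeta q) V -> exists xi, tangent_quot q xi /\ Dtbeta xi = V.
Proof.
move=> [Y rY <-]; rewrite tbeta_gram => /(tangent_psdP _ rY)[A ->].
exists (Dproj Y A); rewrite Dtbeta_Dproj; split=> //.
by apply/(tangent_quotP rY); exists A.
Qed.

(** Makes [sympart Y (hlift Y xi)] independent of the representative; the metric and the objective
    of the initial step depend on the lift only through this matrix. *)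
Lemma sympart_hlift Y xi : fullrank Y -> tangent_quot (qproj Y) xi ->
  horizontal Y (hlift Y xi) /\ sympart Y (hlift Y xi) = Dtbeta xi.
Proof.
move=> rY /(tangent_quotP rY)[A ->]; have [hA hE] := Dproj_hlift rY A.
split; first exact: hA.
exact: (etrans (esym (Dtbeta_Dproj _ _)) (congr1 (@Dtbeta R n p) hE)).
Qed.

Lemma quot_metricE q xi zeta : quotient_set q ->
  tangent_quot q xi -> tangent_quot q zeta ->
  quot_metric q xi zeta = inner (Dtbeta xi) (Dtbeta zeta).
Proof.
move=> Qq; have [rY {1 2}<-] := quotient_repr Qq.
move=> /(sympart_hlift rY)[hx <-] /(sympart_hlift rY)[_ <-].
exact: g3_horizontal.
Qed.

Lemma tbeta_psd_rank q : quotient_set q -> psd_rank R n p (tbeta q).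
Proof. by move=> [Y rY <-]; rewrite tbeta_gram; exact: gram_psd_rank. Qed.

Lemma tbeta_invP X : psd_rank R n p X ->
  quotient_set (@tbeta_inv R n p X) /\ tbeta (@tbeta_inv R n p X) = X.
Proof.
move=> /psd_rank_gram[Y rY YX];
apply: (@xgetPex _ set0 [set q | quotient_set q /\ @tbeta R n p q = X]).
by exists (qproj Y); split; [exists Y|rewrite tbeta_gram].
Qed.

Lemma Dtbeta_invP q V : quotient_set q ->
  tangent (psd_rank R n p) (tbeta q) V ->
  tangent_quot q (Dtbeta_inv q V) /\ Dtbeta (Dtbeta_inv q V) = V.
Proof.
move=> Qq /(Dtbeta_onto Qq).
exact: (@xgetPex _ 0 [set xi | tangent_quot q xi /\ Dtbeta xi = V]).
Qed.

(* Dtbeta identifies the sets of which the gradients are selected; when they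
   are empty, both gradients take the default value 0. *)
Lemma grad_tbeta (f : cmat R n n -> R) q :
  smooth_on setT (f : cmat R n n -> R^o) -> quotient_set q ->
  let g := grad (M := quot_manifold R n p) (fun q => f (tbeta q)) q in
  tangent_quot q g /\ Dtbeta g = grad (M := psd_manifold R n p) f (tbeta q).
Proof.
move=> sf Qq.
have dfE zeta : tangent_quot q zeta ->
    zeta (fun q => f (tbeta q)) = 'D_(Dtbeta zeta) (f : cmat R n n -> R^o) (tbeta q).
  case: Qq => [Y rY <-] /(tangent_quotP rY)[A ->].
  by rewrite (Dproj_tbeta _ _ sf) Dtbeta_Dproj tbeta_gram.
rewrite /= /grad.
set GQ := [set xi | _]; set GE := [set xi | _].
have GQE xi : GQ xi -> GE (Dtbeta xi).
  move=> [Tx gx]; split; first exact: Dtbeta_tangent.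
  move=> _ /(Dtbeta_onto Qq)[zeta [Tz <-]] /=.
  rewrite -(quot_metricE Qq Tx Tz) -(dfE _ Tz); exact: gx.
have GEQ V : GE V -> exists xi, GQ xi.
  move=> [TV gV]; have [xi [Tx xE]] := Dtbeta_onto Qq TV.
  exists xi; split=> // zeta Tz.
  rewrite /= (quot_metricE Qq Tx Tz) xE (dfE _ Tz); exact/gV/Dtbeta_tangent.
have GE1 V W : GE V -> GE W -> V = W.
  move=> [TV gV] [TW gW]; apply/eqP; rewrite -subr_eq0; apply/eqP/inner_eq0.
  (* The difference of two velocities is recognized as a velocity by lifting both to the quotient,
     where tangent vectors form a linear space. *)
  have T : tangent (psd_rank R n p) (tbeta q) (V - W).
    have [xi [Tx <-]] := Dtbeta_onto Qq TV.
    have [zeta [Tz <-]] := Dtbeta_onto Qq TW.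
    rewrite -linearB; apply: Dtbeta_tangent => //.
    by rewrite addrC -scaleN1r; exact: tangent_quot_linear.
  by rewrite innerBl; move: (gV _ T) (gW _ T) => /= -> ->; rewrite subrr.
have [[V GV]|GE0] := pselect (exists V, GE V).
  have G := xgetPex (0 : vec (quot_manifold R n p)) (GEQ _ GV).
  split; first exact: G.1.
  by apply: GE1; [exact: GQE|apply: (xgetPex 0); exists V].
rewrite !xgetPN//; first by split; [exact: tangent_quot0|exact: linear0].
  by move=> V GV; apply: GE0; exists V.
by move=> xi Gx; apply: GE0; exists (Dtbeta xi); exact: GQE.
Qed.

End QuotientGeometry.

(** * Step-by-step comparison of the two methods *)

Section Equivalence.
Context {R : realType} {n p : nat}.
Variables (f : cmat R n n -> R) (RE : cmat R n n -> cmat R n n -> cmat R n n).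
Variable TE : cmat R n n -> cmat R n n -> cmat R n n -> cmat R n n.
Hypothesis sf : smooth_on setT (f : cmat R n n -> R^o).
Hypothesis hRE : retraction (psd_rank R n p) RE.
Hypothesis hTE : vector_transport (psd_rank R n p) RE TE.
Variables (eps : R) (sel : nat -> (R -> R) -> R).
Variable rep : nat -> quot R n p -> cmat R n p.
Hypothesis hrep : forall k q, quotient_set q -> qproj (rep k q) = q.

Implicit Types (q : quot R n p) (xi eta zeta : @qvec R n p).

Let QM := quot_manifold R n p.
Let EM := psd_manifold R n p.
Let h : pt QM -> R := fun q => f (tbeta q).
Let RQ : pt QM -> vec QM -> pt QM := quot_retraction RE.
Let TQ : pt QM -> vec QM -> vec QM -> vec QM := quot_transport RE TE.
Let stepQ := step_quotient sel f rep.
Let stepE : nat -> pt EM -> vec EM -> option R := step_embedded sel f.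

(** The invariant of the quotient method: outside these sets the chosen lifts and inverses may be
    default values and say nothing about the embedded method. *)
Definition valid_state (s : state QM) : Prop :=
  quotient_set s.1 /\
  if s.2 is Some (xi, eta) then tangent_quot s.1 xi /\ tangent_quot s.1 eta else True.

Definition tbeta_state (s : state QM) : state EM :=
  (tbeta s.1, omap (fun v => (Dtbeta v.1, Dtbeta v.2)) s.2).

Lemma quot_retractionP q zeta : quotient_set q -> tangent_quot q zeta ->
  quotient_set (RQ q zeta) /\ tbeta (RQ q zeta) = RE (tbeta q) (Dtbeta zeta).
Proof.
move=> Qq Tz; apply: tbeta_invP; case: hRE => + _ _ _; apply.
  exact: tbeta_psd_rank.
exact: Dtbeta_tangent.
Qed.

Lemma quot_transportP q zeta xi :
  quotient_set q -> tangent_quot q zeta -> tangent_quot q xi ->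
  tangent_quot (RQ q zeta) (TQ q zeta xi) /\
  Dtbeta (TQ q zeta xi) = TE (tbeta q) (Dtbeta zeta) (Dtbeta xi).
Proof.
move=> Qq Tz Tx; have [QR RE'] := quot_retractionP Qq Tz.
apply: Dtbeta_invP => //; rewrite RE'.
by case: hTE => _ + _ _ _; apply; [exact: tbeta_psd_rank|exact: Dtbeta_tangent..].
Qed.

Lemma tangent_quotZ q (a : R) xi : quotient_set q ->
  tangent_quot q xi -> tangent_quot q (a *: xi).
Proof.
move=> Qq Tx; rewrite -[a *: xi]addr0.
exact/tangent_quot_linear/tangent_quot0.
Qed.

Lemma DtbetaZ (a : R) xi : Dtbeta (a *: xi) = a *: Dtbeta xi.
Proof. exact: linearZ. Qed.

Lemma DtbetaN xi : Dtbeta (- xi) = - Dtbeta xi.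
Proof. exact: linearN. Qed.

Lemma DtbetaD xi zeta : Dtbeta (xi + zeta) = Dtbeta xi + Dtbeta zeta.
Proof. exact: linearD. Qed.

Lemma armijo_tbeta q xi eta t m : quotient_set q ->
  tangent_quot q xi -> tangent_quot q eta ->
  armijo (M := EM) f RE (tbeta q) (Dtbeta xi) (Dtbeta eta) t m
  = armijo (M := QM) h RQ q xi eta t m.
Proof.
move=> Qq Tx Te; rewrite /armijo /=.
have [_ RE'] := quot_retractionP Qq (tangent_quotZ (2^-1 ^+ m * t) Qq Te).
rewrite /h RE' (quot_metricE Qq Tx Te). by rewrite DtbetaZ.
Qed.

Lemma armijo_exponent_tbeta q xi eta t : quotient_set q ->
  tangent_quot q xi -> tangent_quot q eta ->
  armijo_exponent (M := EM) f RE (tbeta q) (Dtbeta xi) (Dtbeta eta) t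
  = armijo_exponent (M := QM) h RQ q xi eta t.
Proof.
move=> Qq Tx Te; rewrite /armijo_exponent.
(* Equal as predicates, the two tests have the same existence statement and the same least
   exponent. *)
by rewrite (funext (fun m => armijo_tbeta t m Qq Tx Te)).
Qed.

(** The two scalar objectives are the same function of [t], so they have the same minimizers and
    [sel] returns the same one. *)
Lemma step_tbeta k q eta : quotient_set q -> tangent_quot q eta ->
  stepE k (tbeta q) (Dtbeta eta) = stepQ k q eta.
Proof.
move=> Qq Te; have qE := hrep k Qq.
have rY : fullrank (rep k q) by apply: qproj_fullrank; rewrite qE.
rewrite -qE in Te; have [_ <-] := sympart_hlift rY Te.
by rewrite -{1}qE tbeta_gram.
Qed.

Lemma rcg_step_tbeta k s : valid_state s ->
  rcg_step (M := EM) f RE TE stepE eps k (tbeta_state s)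
    = omap tbeta_state (rcg_step (M := QM) h RQ TQ stepQ eps k s) /\
  forall s', rcg_step (M := QM) h RQ TQ stepQ eps k s = Some s' -> valid_state s'.
Proof.
case: s => q [[xi eta]|] [/= Qq]; last by [].
move=> [Tx Te]; rewrite (step_tbeta k Qq Te).
case: (stepQ k q eta) => [t|]; last by [].
rewrite (armijo_exponent_tbeta t Qq Tx Te).
case: (armijo_exponent _ _ _ _ _ _) => [m|]; last by [].
set c := 2^-1 ^+ m * t.
have zE : c *: Dtbeta eta = Dtbeta (c *: eta) by rewrite DtbetaZ.
have Tz := tangent_quotZ c Qq Te; move: (c *: eta) zE Tz => zeta zE Tz.
cbv zeta.
rewrite zE /=.
have [QR RE'] := quot_retractionP Qq Tz.
have [TTx TTxE] := quot_transportP Qq Tz Tx.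
have [TTe TTeE] := quot_transportP Qq Tz Te.
have [Tg gE] := grad_tbeta sf QR; rewrite -/h -/QM in Tg gE.
rewrite -RE' -TTxE -TTeE -gE.
(* All embedded quantities are now images of quotient ones; only tangency matters from here on, so
   the gradient, the transports and the new point become variables. *)
move: (grad h (RQ q zeta)) Tg {gE} => g Tg.
move: (TQ q zeta xi) (TQ q zeta eta) TTx TTe {TTxE TTeE} => tx te Ttx Tte.
move: (RQ q zeta) QR {RE'} Tg Ttx Tte => q' Qq' Tg Ttx Tte.
have Tgx : tangent_quot q' (g - tx).
  by rewrite addrC -scaleN1r; exact: tangent_quot_linear.
rewrite (quot_metricE Qq' Tg Tg) (quot_metricE Qq' Tg Tgx) (quot_metricE Qq Tx Tx).
rewrite [Dtbeta (g - tx)]DtbetaD DtbetaN.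
(* Both stopping tests have become the same boolean, so the methods stop together. *)
case: ifP => _; first by split=> // _ [<-].
split=> [|_ [<-]].
  by rewrite /tbeta_state /= DtbetaD DtbetaZ DtbetaN.
split=> //=; split=> //.
rewrite addrC; apply: tangent_quot_linear => //.
by rewrite -scaleN1r; exact: tangent_quotZ.
Qed.

Lemma rcg_state_tbeta q k : quotient_set q ->
  let sQ := rcg_state (M := QM) h RQ TQ stepQ eps q k in
  rcg_state (M := EM) f RE TE stepE eps (tbeta q) k = omap tbeta_state sQ /\
  forall s, sQ = Some s -> valid_state s.
Proof.
move=> Qq; elim: k => [|k [IH valid]] /=.
  have [Tg gE] := grad_tbeta sf Qq.
  split=> [|_ [<-]]; first by rewrite /tbeta_state /= DtbetaN gE.
  split=> //=; split=> //.
  by rewrite -scaleN1r; exact: tangent_quotZ.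
rewrite IH; move: valid; case: (rcg_state _ _ _ _ _ _ k) => [s|//] /(_ s erefl).
exact: rcg_step_tbeta.
Qed.

Lemma rcg_iterate_tbeta q k : quotient_set q ->
  let itQ := rcg_iterate (M := QM) h RQ TQ stepQ eps q k in
  rcg_iterate (M := EM) f RE TE stepE eps (tbeta q) k = omap (@tbeta R n p) itQ /\
  forall q', itQ = Some q' -> quotient_set q'.
Proof.
move=> Qq; have [E valid] := rcg_state_tbeta k Qq.
rewrite /rcg_iterate E; move: valid.
case: (rcg_state _ _ _ _ _ _ k) => [s|//] /(_ s erefl) [Qs _].
by split=> // _ [<-].
Qed.

End Equivalence.

(** Equality of options also records that an iterate is defined for one method exactly when it is
    for the other; the second conjunct expresses it with the representative used at iteration
    [k]. *)
Theorem theorem5p6 (R : realType) (n p : nat) (hp : (1 <= p <= n)%N)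
  (f : cmat R n n -> R)
  (hf : smooth_on setT (f : cmat R n n -> R^o))
  (RE : cmat R n n -> cmat R n n -> cmat R n n)
  (hRE : retraction (psd_rank R n p) RE)
  (TE : cmat R n n -> cmat R n n -> cmat R n n -> cmat R n n)
  (hTE : vector_transport (psd_rank R n p) RE TE)
  (eps : R) (heps : 0 < eps)
  (sel : nat -> (R -> R) -> R) (hsel : selection_rule sel)
  (rep : nat -> quot R n p -> cmat R n p)
  (hrep : forall k q, quotient_set q -> qproj (rep k q) = q)
  (Y0 : cmat R n p) (hY0 : fullrank Y0)
  (X0 : cmat R n n) (hX0 : X0 = Y0 *m Y0^t*) :
  let h := fun q => f (tbeta q) in
  let Xit := rcg_iterate (M := psd_manifold R n p) f RE TE
               (step_embedded sel f) eps X0 in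
  let Qit := rcg_iterate (M := quot_manifold R n p) h
               (quot_retraction RE) (quot_transport RE TE)
               (step_quotient sel f rep) eps (qproj Y0) in
  forall k : nat,
    Xit k = omap (@tbeta R n p) (Qit k) /\
    forall q, Qit k = Some q ->
      Xit k = Some (rep k q *m (rep k q)^t*).
Proof.
move=> h Xit Qit k.
have Qq : quotient_set (qproj Y0) by exists Y0.
have X0E : X0 = tbeta (qproj Y0) by rewrite tbeta_gram.
have [E quotQ] := rcg_iterate_tbeta hf hRE hTE eps sel hrep k Qq.
rewrite /Xit X0E E; split=> // q Qk.
by rewrite -/Qit in E *; rewrite Qk /= -{1}(hrep k _ (quotQ _ Qk)) tbeta_gram.
Qed.
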